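(* Let $\alpha$ be a composition and $n$ a positive integer. Then $$\mathcal S_{(n)}\mathcal S_\alpha=\sum_\beta\mathcal S_\beta,$$ where the sum is over all compositions $\beta$ such that $\lambda(\alpha)\subseteq\lambda(\beta)$, the skew diagram $\delta=\lambda(\beta)/\lambda(\alpha)$ is a horizontal strip with $|\delta|=n$, and $row_{S(\delta)}(\beta)=\alpha$. Also, $$\mathcal S_{(1^n)}\mathcal S_\alpha=\sum_\beta\mathcal S_\beta,$$ where the sum is over all compositions $\beta$ such that $\lambda(\alpha)\subseteq\lambda(\beta)$, the skew diagram $\epsilon=\lambda(\beta)/\lambda(\alpha)$ is a vertical strip with $|\epsilon|=n$, and $col_{M(\epsilon)}(\beta)=\alpha$.
   Context: A weak composition is a finite sequence $\gamma=(\gamma_1,\dots,\gamma_n)$ of nonnegative integers; a composition has all parts positive; $\alpha(\gamma)$ is obtained from $\gamma$ by deleting zero parts; $\lambda(\gamma)$ is the partition obtained by sorting the positive parts of $\gamma$ weakly decreasingly. $(1^n)$ denotes the composition with $n$ parts equal to $1$. Diagrams. The Ferrers diagram of a partition $\lambda$ has $\lambda_i$ left-justified cells in row $i$ (from the top); $\mu\subseteq\lambda$ means $\mu_i\le\lambda_i$ for all $i$, and $\lambda/\mu$ is the set of cells of $\lambda$ not in $\mu$, $|\lambda/\mu|$ its number of cells. It is a horizontal strip if no two of its cells are in the same column, and a vertical strip if no two are in the same row. For a horizontal strip $\delta$, $S(\delta)$ is the set of columns containing its cells; for a vertical strip $\epsilon$, $M(\epsilon)$ is the multiset of columns containing its cells,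 each column with multiplicity equal to the number of cells of $\epsilon$ in it. Operators. For a composition (possibly with some zero parts) $\alpha=(\alpha_1,\dots,\alpha_k)$ and positive integer $s$: if some part equals $s$, let $i$ be the largest index with $\alpha_i=s$ and set $rem_s(\alpha)=(\alpha_1,\dots,\alpha_{i-1},s-1,\alpha_{i+1},\dots,\alpha_k)$; otherwise $rem_s(\alpha)$ is the empty composition. For a set $S=\{s_1<\dots<s_j\}$, $row_S(\alpha)=rem_{s_1}(\cdots rem_{s_{j-1}}(rem_{s_j}(\alpha))\cdots)$. For a multiset $M=\{m_1\le\dots\le m_j\}$, $col_M(\alpha)=rem_{m_j}(\cdots rem_{m_2}(rem_{m_1}(\alpha))\cdots)$. The result is collapsed (zero parts deleted) to obtain a composition. Quasisymmetric Schur functions. The augmented diagram of $\gamma=(\gamma_1,\dots,\gamma_n)$ has cells $(i,j)$, $1\le i\le n$ (row, from top), $0\le j\le\gamma_i$ (column); column $0$ is the basement, cell $(i,0)$ containing $i$. An augmented filling assigns positive integers to non-basement cells. Cells $(i,j),(i',j')$ attack if $j=j'$, or $j=j'+1$ and $i>i'$; non-attacking means distinct attacking cells (basement included) have distinct entries. When comparing entries in a triple, of two equal entries the one appearing first when read top to bottom, right to left counts as smaller. Type A triple: $c=(i,k-1)$, $a=(i,k)$, $b=(j,k)$, $i<j$, $k\ge1$, $\gamma_i\ge\gamma_j$; inversion triple if in increasing order $a<c<b$, $c<b<a$ or $b<a<c$. Type B triple: $a=(i,k)$, $b=(j,k)$, $c=(j,k+1)$, $i<j$, $k\ge0$, $\gamma_j>\gamma_i$;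 inversion triple if in increasing order $a<c<b$, $c<b<a$ or $b<a<c$. An SSAF of shape $\gamma$ is a non-attacking augmented filling with rows (basement included) weakly decreasing left to right and all type A and B triples inversion triples; $x^F=\prod_i x_i^{w_i(F)}$ with $w_i(F)$ the number of non-basement cells containing $i$. $\mathcal A_\gamma=\sum_F x^F$ over SSAFs of shape $\gamma$, and $\mathcal S_\alpha=\sum_\gamma\mathcal A_\gamma$ over weak compositions $\gamma$ with positive last part and $\alpha(\gamma)=\alpha$ (formal power series in $x_1,x_2,\dots$). *)

(* Defs.v *)
From HB Require Import structures.
From mathcomp Require Import all_boot all_order all_algebra.
From mathcomp Require Import finmap boolp classical_sets fsbigop.
From mathcomp.multinomials Require Import monalg.

Set Implicit Arguments.
Unset Strict Implicit.
Unset Printing Implicit Defensive.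

Import GRing.Theory.
Local Open Scope classical_set_scope.
Local Open Scope nat_scope.

(* Formal power series over the integers in x_1, x_2, ..., given by their
   coefficients. The generator [ucm i] of the monomials {cmonom nat} stands for
   x_(i + 1), so that all generators are used. *)
Definition fps : Type := {cmonom nat} -> int.

Definition fps_monomial (m : {cmonom nat}) : fps := fun m' => ((m' == m)%:R)%R.

Definition fps_mul (f g : fps) : fps := fun m =>
  (\sum_(p \in [set p : {cmonom nat} * {cmonom nat} | mmul p.1 p.2 = m])
     f p.1 * g p.2)%R.

(* Formal sum of a family of series, coefficient by coefficient. It is meant
   for families in which every monomial has a nonzero coefficient in finitely
   many members only. *)
Definition fps_sum (I : choiceType) (P : set I) (f : I -> fps) : fps :=
  fun m => (\sum_(i \in P) f i m)%R.

(* A weak composition is any [seq nat]; compositions include the empty one. *)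
Definition is_composition (a : seq nat) : bool := all (leq 1) a.

Definition collapse (g : seq nat) : seq nat := [seq k <- g | 0 < k].

Definition sort_partition (g : seq nat) : seq nat := sort geq (collapse g).

(* Cells are pairs (row, column). In all diagrams rows are numbered from 0;
   the columns of Ferrers diagrams are numbered from 1. *)
Definition ferrers (l : seq nat) : seq (nat * nat) :=
  [seq (i, j) | i <- iota 0 (size l), j <- iota 1 (nth 0 l i)].

Definition included (mu la : seq nat) : Prop :=
  forall i, nth 0 mu i <= nth 0 la i.

Definition skew (la mu : seq nat) : seq (nat * nat) :=
  [seq c <- ferrers la | c \notin ferrers mu].

Definition horizontal_strip (d : seq (nat * nat)) : Prop :=
  {in d &, forall c c', c.2 = c'.2 -> c = c'}.

Definition vertical_strip (d : seq (nat * nat)) : Prop :=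
  {in d &, forall c c', c.1 = c'.1 -> c = c'}.

Definition strip_colset (d : seq (nat * nat)) : seq nat :=
  undup [seq c.2 | c <- d].

Definition strip_colmset (d : seq (nat * nat)) : seq nat :=
  [seq c.2 | c <- d].

(* The last occurrence of s in a is the first one in [rev a]. *)
Definition rem_part (s : nat) (a : seq nat) : seq nat :=
  if s \in a then rev (set_nth 0 (rev a) (index s (rev a)) s.-1) else [::].

(* Largest column first. *)
Definition row_op (S a : seq nat) : seq nat :=
  collapse (foldr rem_part a (sort leq S)).

(* Smallest column first. *)
Definition col_op (M a : seq nat) : seq nat :=
  collapse (foldl (fun b m => rem_part m b) a (sort leq M)).

(* Column 0 is the basement; since rows are numbered from 0, the basement
   entry of row i is i.+1. *)
Definition aug_cell (g : seq nat) (c : nat * nat) : bool :=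
  (c.1 < size g) && (c.2 <= nth 0 g c.1).

(* A filling lists the rows of its non-basement entries. *)
Definition entry (F : seq (seq nat)) (c : nat * nat) : nat :=
  nth 0 (c.1.+1 :: nth [::] F c.1) c.2.

Definition attacks (c d : nat * nat) : bool :=
  (c.2 == d.2) || ((c.2 == d.2.+1) && (d.1 < c.1)).

(* Columns are read from right to left, each from top to bottom. *)
Definition read_before (c d : nat * nat) : bool :=
  (d.2 < c.2) || ((c.2 == d.2) && (c.1 < d.1)).

Definition entry_lt (F : seq (seq nat)) (c d : nat * nat) : bool :=
  (entry F c < entry F d) || ((entry F c == entry F d) && read_before c d).

Definition inversion_triple (F : seq (seq nat)) (a b c : nat * nat) : bool :=
  [|| entry_lt F a c && entry_lt F c b,
      entry_lt F c b && entry_lt F b a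
    | entry_lt F b a && entry_lt F a c].

Record is_ssaf (g : seq nat) (F : seq (seq nat)) : Prop := IsSSAF {
  ssaf_shape : shape F = g;
  ssaf_pos : all (all (leq 1)) F;
  ssaf_rows : forall i k,
    aug_cell g (i, k.+1) -> entry F (i, k.+1) <= entry F (i, k);
  ssaf_nonattacking : forall c d, aug_cell g c -> aug_cell g d ->
    c <> d -> attacks c d -> entry F c <> entry F d;
  ssaf_typeA : forall i j k, i < j -> nth 0 g j <= nth 0 g i ->
    aug_cell g (i, k.+1) -> aug_cell g (j, k.+1) ->
    inversion_triple F (i, k.+1) (j, k.+1) (i, k);
  ssaf_typeB : forall i j k, i < j -> nth 0 g i < nth 0 g j ->
    aug_cell g (i, k) -> aug_cell g (j, k.+1) ->
    inversion_triple F (i, k) (j, k) (j, k.+1) }.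

Definition weight (F : seq (seq nat)) : {cmonom nat} :=
  \big[mmul/mone]_(e <- flatten F) ucm e.-1.

(* There are finitely many SSAFs of shape g, as row i only has entries in
   {1, ..., i.+1}. *)
Definition demazure_atom (g : seq nat) : fps :=
  fps_sum [set F | is_ssaf g F] (fun F => fps_monomial (weight F)).

(* An SSAF of shape g with positive last part has the entry [size g] in the
   first column of its last row, so a given monomial occurs in finitely many
   terms. The last part of the empty weak composition is read as positive:
   [qschur [::]] is 1. *)
Definition qschur (a : seq nat) : fps :=
  fps_sum [set g | 0 < last 1 g /\ collapse g = a] demazure_atom.

(* Main.v *)
From HB Require Import structures.
From mathcomp Require Import all_boot all_order all_algebra.
From mathcomp Require Import finmap boolp classical_sets functions fsbigop.
From mathcomp Require Import zify.
From mathcomp.multinomials Require Import monalg.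
Require Import Defs.

Set Implicit Arguments.
Unset Strict Implicit.
Unset Printing Implicit Defensive.

Import GRing.Theory.
Local Open Scope nat_scope.

(* Number the columns from 0. On compositions, let t_k increase the first part
   k to k + 1 (t_0 puts a new part 1 in front), let r_k decrease the last part
   k + 1 to k (deleting it if k = 0), and let p_k be the projection on the
   compositions that have a part k (p_0 = 1). Then t_i and r_j commute for
   i <> j, while r_k t_k - t_k r_k = p_k - p_{k+1}.

   Removing the entries of an SSAF in increasing order, equal entries from right
   to left, identifies the SSAFs with the words in the t_k, so that S_a is the
   coefficient of a in T(x_1) T(x_2) ... applied to the empty composition, where
   T(x) = ... (1 + x t_1) (1 + x t_0).
   The horizontal strips of the theorem are the terms of
   R(y) = (1 + y r_0) (1 + y r_1) ... and the vertical ones those of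
   C(y) = R(-y)^-1. With Z_k = 1 - x y + x y p_k the relations above give
   (1 + y r_k) Z_{k+1} (1 + x t_k) = (1 + x t_k) Z_k (1 + y r_k), and these
   exchanges telescope to (1 - x y) R(y) T(x) = T(x) R(y), since Z_0 = 1 and
   Z_k = 1 - x y on compositions without a part k. As R(y) fixes the empty
   composition, sum_n y^n sum_b S_b, where b runs over the compositions with a
   horizontal strip of size n over a, is S_a / prod_i (1 - x_i y). For a empty
   this is sum_n y^n S_(n), which proves the first formula; C(y) gives
   prod_i (1 + x_i y) and the second one in the same way. *)

(** * Growing and shrinking compositions *)

Fixpoint inc_first (k : nat) (b : seq nat) : option (seq nat) :=
  if b is x :: b' then
    if x == k then Some (k.+1 :: b') else omap (cons x) (inc_first k b')
  else None.

Definition grow (k : nat) (b : seq nat) : option (seq nat) :=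
  if k is 0 then Some (1 :: b) else inc_first k b.

(** The recursion tries the tail first, so the last part [k.+1] is the one decreased. For [k = 0]
    the part is deleted at once, which keeps compositions free of zeros. *)
Fixpoint shrink (k : nat) (b : seq nat) : option (seq nat) :=
  if b is x :: b' then
    if shrink k b' is Some c then Some (x :: c)
    else if x == k.+1 then Some (if k is 0 then b' else k :: b') else None
  else None.

Definition has_part (k : nat) (b : seq nat) : bool := (k == 0) || (k \in b).

Lemma inc_first_None k b : k \notin b -> inc_first k b = None.
Proof.
elim: b => //= x b IH;
  rewrite inE negb_or eq_sym => /andP[/negbTE -> /IH ->] //.
Qed.

Lemma shrink_None k b : k.+1 \notin b -> shrink k b = None.
Proof.
elim: b => //= x b IH; rewrite inE negb_or eq_sym.
by move=> /andP[/negbTE -> /IH ->].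
Qed.

Lemma inc_first_Some k b : k \in b -> exists c, inc_first k b = Some c.
Proof.
elim: b => //= x b IH; rewrite inE eq_sym; case: eqP => [_ _|_ /= /IH[c ->]].
  by eexists.
by exists (x :: c).
Qed.

Lemma shrink_Some k b : k.+1 \in b -> exists c, shrink k b = Some c.
Proof.
elim: b => //= x b IH; rewrite inE eq_sym.
case/orP=> [/eqP ->|/IH[c ->]]; last by eexists.
by case: (shrink k b) => [c|]; rewrite ?eqxx; eexists.
Qed.

Lemma grow_None k b : ~~ has_part k b -> grow k b = None.
Proof. by rewrite negb_or => /andP[]; case: k => // k _ /inc_first_None. Qed.


Lemma mem_shrink i j b e : shrink j b = Some e -> i != j.+1 -> i \in b ->
  i \in e.
Proof.
elim: b e => //= x b IH e; case E: (shrink j b) => [c|].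
  by case=> <- ij; rewrite !inE => /orP[->//|/(IH _ E ij) ->]; rewrite orbT.
case: eqP => // -> [<-] ij; rewrite inE (negbTE ij) /= => ib.
by case: j {IH E ij} => [|j] //; rewrite inE ib orbT.
Qed.

(** For [i = j.+1] both operators need a part [i]: a single one makes both composites undefined; of
    several, the first is increased and the last decreased. Otherwise the operators act on parts of
    different sizes, and neither creates a part that the other acts on. *)
Lemma inc_first_shrink i j b : 0 < i -> i != j ->
  obind (shrink j) (inc_first i b) = obind (inc_first i) (shrink j b).
Proof.
move=> i0 ij; elim: b => //= x b IH.
have [->|xi] := eqVneq x i.
  rewrite /=; case E: (shrink j b) => [c|]; rewrite /= ?eqxx //.
  rewrite eqSS (negbTE ij); case: eqP => // ij1.
  have bN : i \notin b.
    by apply/negP; rewrite ij1 => /shrink_Some[c]; rewrite E.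
  case: j ij {IH E} ij1 => [|j] ij ij1 /=; rewrite inc_first_None //.
  by rewrite eq_sym (negbTE ij).
case Ei: (inc_first i b) IH => [c|] /=; case Ej: (shrink j b) => [e|] /= IH;
  rewrite ?IH ?(negbTE xi) //=.
- case Ee: (inc_first i e) => //=; case: eqP => // xj.
  have : i \in e.
    apply: (mem_shrink Ej); first by rewrite -xj eq_sym.
    by apply: contraT => /inc_first_None; rewrite Ei.
  by move=> /inc_first_Some[d]; rewrite Ee.
- case: eqP => // xj; case: j {IH Ej xj} ij => [|j] ij /=; rewrite Ei //.
  by rewrite eq_sym (negbTE ij).
- by rewrite -IH.
- case: eqP => // xj; case: j {IH Ej xj} ij => [|j] ij /=; rewrite Ei //.
  by rewrite eq_sym (negbTE ij).
Qed.

Lemma grow_shrink i j b : i != j ->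
  obind (shrink j) (grow i b) = obind (grow i) (shrink j b).
Proof.
case: i => [|i] ij; last exact: inc_first_shrink.
rewrite /=; case: (shrink j b) => //=.
by rewrite eqSS (negbTE ij).
Qed.

(** With [shrink_has] this makes Z_{k+1} the identity on the image of t_k and Z_k the identity on
    the image of r_k. *)
Lemma grow_has k b c : grow k b = Some c -> has_part k.+1 c.
Proof.
rewrite /has_part /=; case: k => [[<-]|k]; first by rewrite inE.
rewrite /grow; elim: b c => //= x b IH c; case: eqP => _.
  by case=> <-; rewrite inE eqxx.
by case: (inc_first _ b) IH => //= d IH [<-]; rewrite inE IH ?orbT.
Qed.

Lemma shrink_has k b c : shrink k b = Some c -> has_part k c.
Proof.
rewrite /has_part; case: k => // k /=; elim: b c => //= x b IH c.
case: (shrink _ b) IH => [d IH [<-]|_]; first by rewrite inE IH ?orbT.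
by case: eqP => // _ [<-]; rewrite inE eqxx.
Qed.

Lemma grow_then_shrink k b : has_part k b -> ~~ has_part k.+1 b ->
  obind (shrink k) (grow k b) = Some b.
Proof.
rewrite /has_part /=; case: k => [_ /= bN|k /=].
  by rewrite /= shrink_None.
elim: b => //= x b IH; rewrite !inE negb_or;
  have [->|xk] := eqVneq x k.+1 => /=.
  by move=> _ /andP[_ bN]; rewrite shrink_None // eqxx.
move=> kb /andP[_ bN].
by have [d Ed] := inc_first_Some kb; move: IH; rewrite Ed /= => ->.
Qed.

Lemma shrink_then_grow k b : ~~ has_part k b -> has_part k.+1 b ->
  obind (grow k) (shrink k b) = Some b.
Proof.
rewrite /has_part /=; case: k => // k /=.
elim: b => //= x b IH; rewrite !inE negb_or => /andP[xk bN] xb.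
case E: (shrink _ b) => [c|] /=.
  rewrite eq_sym (negbTE xk); move: IH; rewrite E /= => -> //.
  by apply: contraT => /shrink_None; rewrite E.
have: k.+2 \notin b by apply/negP => /shrink_Some[c]; rewrite E.
move=> bN'; move: xb; rewrite (negbTE bN') orbF => /eqP <-.
by rewrite eqxx /= eqxx.
Qed.

(** If the first part [k] precedes the last part [k.+1], the operators act on these two in either
    order. Otherwise the second operator meets the part just changed by the first, and both
    composites give [b] back. For [k = 0] the new part stands in front, as in the first case. *)
Lemma grow_shrink_both k b : has_part k b -> has_part k.+1 b ->
  obind (shrink k) (grow k b) = obind (grow k) (shrink k b).
Proof.
case: k => [_ /=|k].
  by rewrite /has_part /= => /shrink_Some[c ->].
rewrite /has_part /=; elim: b => //= x b IH.
rewrite !inE; have [->|xk] := eqVneq x k.+1 => /=.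
  rewrite (_ : (k.+2 == k.+1) = false) /=; last by apply/eqP; lia.
  by move=> _ /shrink_Some[c E]; rewrite E /= eqxx.
move=> kb.
have [d Ed] := inc_first_Some kb; rewrite Ed /=.
have [kkb _|kkb] := boolP (k.+2 \in b).
  have dk : k.+2 \in d by have := @grow_has k.+1 b d Ed; rewrite /has_part.
  have [d' Ed'] := shrink_Some dk; rewrite Ed' /=.
  move: (IH kb kkb); rewrite Ed /= Ed'; have [c ->] := shrink_Some kkb => /= <-.
  by rewrite (negbTE xk).
(* The head is the only part [k.+2] and precedes every part [k.+1]. *)
rewrite orbF => /eqP <-; rewrite (shrink_None kkb) eqxx /= eqxx.
have := @grow_then_shrink k.+1 b; rewrite /has_part /= => /(_ kb kkb).
by rewrite Ed /= => ->.
Qed.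

(** * Transposed operators on functions of compositions *)

Section PullBack.
Local Open Scope ring_scope.
Variable M : zmodType.
Implicit Types (f g : seq nat -> M) (b : seq nat) (x y z : {additive M -> M}).

(** The transpose of 1 + z act, where an undefined image contributes 0. Transposing reverses
    products: the outermost [step] acts on the composition first. Multiplication by a variable
    enters only as an additive map. *)
Definition step (act : seq nat -> option (seq nat)) z f b : M :=
  f b + z (oapp f 0 (act b)).

(** T(x) cut off at the columns below [N], smallest column first; [shrink_strip] is R(y), largest
    column first. *)
Fixpoint grow_strip x (N : nat) f : seq nat -> M :=
  if N is N'.+1 then grow_strip x N' (step (grow N') x f) else f.

Fixpoint shrink_strip y (N : nat) f : seq nat -> M :=
  if N is N'.+1 then step (shrink N') y (shrink_strip y N' f) else f.

(** The transpose of Z_k. *)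
Definition defect x y (k : nat) f b : M :=
  if has_part k b then f b else f b - x (y (f b)).

Lemma oapp_step act z f o :
  oapp (step act z f) 0 o = oapp f 0 o + z (oapp f 0 (obind act o)).
Proof. by case: o => //=; rewrite raddf0 addr0. Qed.

Lemma step_comm act act' x y f :
  (forall u, x (y u) = y (x u)) ->
  (forall b, obind act' (act b) = obind act (act' b)) ->
  step act x (step act' y f) = step act' y (step act x f).
Proof.
move=> xy aa; apply/funext => b; rewrite {1 3}/step !oapp_step /step !raddfD /=.
by rewrite aa xy !addrA; congr (_ + _); rewrite addrAC.
Qed.

(** Since Z_{k+1} is trivial after t_k and Z_k after r_k, the two sides differ by x y (r_k t_k - t_k
    r_k) and by the diagonal terms of Z_{k+1} and Z_k. These cancel in each of the four cases given
    by the presence of parts [k] and [k.+1]. *)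
Lemma step_exchange k x y f : (forall u, x (y u) = y (x u)) ->
  step (grow k) x (defect x y k.+1 (step (shrink k) y f)) =
  step (shrink k) y (defect x y k (step (grow k) x f)).
Proof.
move=> xy; apply/funext => b; rewrite {1 3}/step.
have -> : oapp (defect x y k.+1 (step (shrink k) y f)) 0 (grow k b) =
    oapp (step (shrink k) y f) 0 (grow k b).
  by case E: (grow k b) => [c|] //=; rewrite /defect (grow_has E).
have -> : oapp (defect x y k (step (grow k) x f)) 0 (shrink k b) =
    oapp (step (grow k) x f) 0 (shrink k b).
  by case E: (shrink k b) => [c|] //=; rewrite /defect (shrink_has E).
rewrite !oapp_step /defect /step.
have [hk|hk] := boolP (has_part k b); have [hS|hS] := boolP (has_part k.+1 b).
- rewrite (grow_shrink_both hk hS) !raddfD /= xy !addrA.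
  by congr (_ + _); rewrite addrAC.
- rewrite (grow_then_shrink hk hS) shrink_None // !raddfD /= !raddf0 !addr0.
  by rewrite addrACA addNr addr0.
- rewrite (shrink_then_grow hk hS) grow_None // !raddfD /= !raddf0 !addr0.
  by rewrite xy addrACA addNr addr0.
by rewrite grow_None // shrink_None //= !(raddf0, addr0).
Qed.

Lemma shrink_grow_strip x y N j f : (forall u, x (y u) = y (x u)) ->
  (N <= j)%N ->
  step (shrink j) y (grow_strip x N f) = grow_strip x N (step (shrink j) y f).
Proof.
move=> xy; elim: N f => //= N IH f Nj; rewrite IH 1?ltnW //; congr grow_strip.
by rewrite step_comm // => b; rewrite grow_shrink // neq_ltn Nj.
Qed.

Lemma grow_shrink_strip x y N j f : (forall u, x (y u) = y (x u)) ->
  (N <= j)%N ->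
  step (grow j) x (shrink_strip y N f) = shrink_strip y N (step (grow j) x f).
Proof.
move=> xy; elim: N => //= N IH Nj; rewrite -IH 1?ltnW //.
by rewrite step_comm // => b; rewrite grow_shrink // neq_ltn Nj orbT.
Qed.

(** Induction on [N]: exchanging in the last column turns its Z into that of the column before,
    after which r and t of the last column move past all smaller columns. The induction ends with
    Z_0 = 1. *)
Theorem strip_exchange x y N f : (forall u, x (y u) = y (x u)) ->
  grow_strip x N (defect x y N (shrink_strip y N f)) =
  shrink_strip y N (grow_strip x N f).
Proof.
move=> xy; elim: N f => [|N IH] f /=; first by apply/funext.
rewrite step_exchange // -shrink_grow_strip // grow_shrink_strip //.
by rewrite IH.
Qed.

Fixpoint shrink_iter y (k j : nat) f b : M :=
  if j is j'.+1 then f b + y (oapp (shrink_iter y k j' f) 0 (shrink k b)) else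
    f b.

(** The transpose of the inverse of 1 - y r_k. On [b] the geometric series stops after as many steps
    as there are parts [k.+1]. *)
Definition shrink_geom y k f b : M := shrink_iter y k (count_mem k.+1 b) f b.

(** C(y): inverting the product R(-y) reverses its factors, so the smallest column now comes first,
    as in [col_op]. *)
Fixpoint shrink_vstrip y (N : nat) f : seq nat -> M :=
  if N is N'.+1 then shrink_vstrip y N' (shrink_geom y N' f) else f.

End PullBack.

Lemma count_shrink k b c : shrink k b = Some c ->
  count_mem k.+1 b = (count_mem k.+1 c).+1.
Proof.
elim: b c => //= x b IH c; case E: (shrink k b) => [d|].
  by move=> [<-] /=; rewrite (IH d) // addnS.
case: eqP => // _ [<-] /=; rewrite add1n; congr _.+1.
by case: k {IH E} => //= k; rewrite eqn_leq ltnn andbF.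
Qed.

(** * Inverting the horizontal strip operator *)

Section VerticalPullBack.
Local Open Scope ring_scope.
Variable M : zmodType.
Implicit Types (f g : seq nat -> M) (b : seq nat) (x y z : {additive M -> M}).

Lemma shrink_geomE y k f b :
  shrink_geom y k f b = f b + y (oapp (shrink_geom y k f) 0 (shrink k b)).
Proof.
rewrite {1}/shrink_geom; case E: (shrink k b) => [c|] /=.
  by rewrite (count_shrink E) /= E.
have -> : count_mem k.+1 b = 0%N.
  by apply/count_memPn/negP => /shrink_Some[c]; rewrite E.
by rewrite /= raddf0 addr0.
Qed.

Variables y y' : {additive M -> M}.
Hypothesis y'E : forall u, y' u = - y u.

Lemma step_shrink_geom k f : step (shrink k) y' (shrink_geom y k f) = f.
Proof. by apply/funext => b; rewrite /step shrink_geomE y'E addrK. Qed.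

Lemma shrink_geom_step k f : shrink_geom y k (step (shrink k) y' f) = f.
Proof.
apply/funext => b; have [n] := ubnP (count_mem k.+1 b).
elim: n b => // n IH b; rewrite shrink_geomE /step y'E.
case E: (shrink k b) => [c|] /=; last by rewrite !(raddf0, oppr0, addr0).
rewrite (count_shrink E) ltnS => lt_cn.
by rewrite IH // subrK.
Qed.

Lemma shrink_stripK N f : shrink_strip y' N (shrink_vstrip y N f) = f.
Proof. by elim: N f => //= N IH f; rewrite IH step_shrink_geom. Qed.

Lemma shrink_vstripK N f : shrink_vstrip y N (shrink_strip y' N f) = f.
Proof. by elim: N f => //= N IH f; rewrite shrink_geom_step. Qed.

(** This is [strip_exchange] at - y for the function [shrink_vstrip y N f], with the strip operator
    then cancelled on both sides. *)
Theorem vstrip_exchange x N f : (forall u, x (y u) = y (x u)) ->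
  shrink_vstrip y N (grow_strip x N (defect x y' N f)) =
  grow_strip x N (shrink_vstrip y N f).
Proof.
move=> xy; have xy' u : x (y' u) = y' (x u) by rewrite !y'E raddfN xy.
rewrite -{1}(shrink_stripK N f) strip_exchange //.
by rewrite shrink_vstripK.
Qed.

End VerticalPullBack.

(** * Composition tableaux as words *)

Definition row_ok (r : seq nat) : bool :=
  [&& r != [::], all (leq 1) r & sorted geq r].

(** The triple condition of composition tableaux for a row [r] above a row [r']. Entries past the
    end of [r] are read as 0, so the premise holds there. *)
Definition triple_rule (r r' : seq nat) : bool :=
  all (fun k => (nth 0 r k.+1 <= nth 0 r' k.+1) ==> (nth 0 r k < nth 0 r' k.+1))
    (iota 0 (size r').-1).

Definition above (r r' : seq nat) : bool :=
  (head 0 r < head 0 r') && triple_rule r r'.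

Definition comp_tableau (T : seq (seq nat)) : bool :=
  all row_ok T && pairwise above T.

(** A cell is recorded by its entry and its column, numbered from 0. The row is left out, as
    insertion determines it. *)
Definition row_cells (r : seq nat) : seq (nat * nat) := zip r (iota 0 (size r)).

Definition cells (T : seq (seq nat)) : seq (nat * nat) :=
  flatten (map row_cells T).

(** The order of letters in a word: larger entries first, equal entries from left to right. This
    reverses the order of removal. *)
Definition cell_lt (c d : nat * nat) : bool :=
  (d.1 < c.1) || ((c.1 == d.1) && (c.2 < d.2)).

Fixpoint put_first (k v : nat) (T : seq (seq nat)) : option (seq (seq nat)) :=
  if T is r :: T' then
    if size r == k then Some (rcons r v :: T')
    else omap (cons r) (put_first k v T')
  else None.

Definition put (c : nat * nat) (T : seq (seq nat)) : option (seq (seq nat)) :=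
  if c.2 is 0 then Some ([:: c.1] :: T) else put_first c.2 c.1 T.

Fixpoint puts (w : seq (nat * nat)) (T : seq (seq nat)) :
    option (seq (seq nat)) :=
  if w is c :: w' then obind (puts w') (put c T) else Some T.

Fixpoint grows (w : seq (nat * nat)) (b : seq nat) : option (seq nat) :=
  if w is c :: w' then obind (grows w') (grow c.2 b) else Some b.

Lemma triple_ruleP r r' :
  reflect (forall k, k.+1 < size r' -> nth 0 r k.+1 <= nth 0 r' k.+1 ->
             nth 0 r k < nth 0 r' k.+1)
          (triple_rule r r').
Proof.
apply: (iffP allP) => [h k kr|h k].
  by have := h k; rewrite mem_iota;
    case: (size r') kr => //= n kr /(_ kr)/implyP.
by rewrite mem_iota => kr; apply/implyP/h; lia.
Qed.

Lemma cell_lt_trans : transitive cell_lt.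
Proof. by move=> [a b] [c d] [e f]; rewrite /cell_lt /=; lia. Qed.

Lemma cell_lt_irr : irreflexive cell_lt.
Proof. by move=> [a b]; rewrite /cell_lt /=; lia. Qed.

Lemma mem_row_cells r v k :
  ((v, k) \in row_cells r) = (k < size r) && (nth 0 r k == v).
Proof.
have sz : size (row_cells r) = size r by rewrite size_zip size_iota minnn.
have nthE j : j < size r -> nth (0, 0) (row_cells r) j = (nth 0 r j, j).
  by move=> jr; rewrite nth_zip ?size_iota // nth_iota.
apply/idP/andP => [/(nthP (0, 0))[j]|[kr /eqP <-]].
  by rewrite sz => jr; rewrite nthE // => -[<- <-].
by rewrite -nthE // mem_nth // sz.
Qed.

Lemma mem_cells T R k : R \in T -> k < size R -> (nth 0 R k, k) \in cells T.
Proof.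
move=> RT kR; apply/flattenP; exists (row_cells R); first exact: map_f.
by rewrite mem_row_cells kR eqxx.
Qed.

Lemma cellsP T v k : (v, k) \in cells T ->
  exists R, [/\ R \in T, k < size R & nth 0 R k = v].
Proof.
move=> /flattenP[_ /mapP[R RT ->]]; rewrite mem_row_cells => /andP[kR /eqP].
by exists R.
Qed.

Lemma row_ok_pos r k : row_ok r -> k < size r -> 0 < nth 0 r k.
Proof. by move=> /and3P[_ /(all_nthP 0) h _] /h. Qed.

Lemma row_ok_dec r k : row_ok r -> nth 0 r k.+1 <= nth 0 r k.
Proof.
move=> /and3P[_ _ /(sortedP 0) h]; have [/h //|] := ltnP k.+1 (size r).
by move=> kr; rewrite (nth_default _ kr).
Qed.

Lemma put_first_cat k v T1 r T2 : size r = k ->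
  all (fun s => size s != k) T1 ->
  put_first k v (T1 ++ r :: T2) = Some (T1 ++ rcons r v :: T2).
Proof.
move=> rk; elim: T1 => [|s T1 IH] /=; first by rewrite rk eqxx.
by move=> /andP[/negbTE -> /IH ->].
Qed.

Lemma put_firstP k v T T' : put_first k v T = Some T' ->
  exists T1 r T2, [/\ T = T1 ++ r :: T2, size r = k,
    all (fun s => size s != k) T1 & T' = T1 ++ rcons r v :: T2].
Proof.
elim: T T' => //= r T IH T'; have [rk [<-]|rk] := eqVneq (size r) k.
  by exists [::], r, T.
case: (put_first k v T) IH =>
  // T0 /(_ T0 erefl)[T1 [s [T2 [-> sk nk ->]]]] [<-].
by exists (r :: T1), s, T2; rewrite /= rk.
Qed.

Lemma row_cells_rcons r v : row_cells (rcons r v) =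
  rcons (row_cells r) (v, size r).
Proof.
rewrite /row_cells size_rcons -addn1 iotaD add0n /= -!cats1 zip_cat ?size_iota
  //.
Qed.

Lemma perm_cells_put v k T T' : put (v, k) T = Some T' ->
  perm_eq (cells T') ((v, k) :: cells T).
Proof.
case: k => [[<-]|k]; first by [].
rewrite /put /= => /put_firstP[T1 [r [T2 [-> rk _ ->]]]].
rewrite /cells !map_cat !flatten_cat /= row_cells_rcons rk -cats1 -!catA.
by rewrite perm_sym -cat1s perm_catCA perm_cat2l perm_catCA.
Qed.

Lemma comp_tableau_cat T1 r T2 : comp_tableau (T1 ++ r :: T2) =
  [&& all row_ok T1, row_ok r, all row_ok T2,
      pairwise above T1, pairwise above T2,
      all (above^~ r) T1, all (above r) T2 & allrel above T1 T2].
Proof.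
rewrite /comp_tableau all_cat pairwise_cat /= allrel_consr.
by rewrite -!andbA; do !bool_congr.
Qed.

(** Every entry present is larger than [v], or equal to [v] in a column left of [k]. A new row on
    top thus has the smallest first entry, and a row that is extended stays weakly decreasing. *)
Lemma put_comp_tableau v k T T' : comp_tableau T -> 0 < v ->
  all (cell_lt^~ (v, k)) (cells T) -> put (v, k) T = Some T' ->
  comp_tableau T'.
Proof.
move=> HT v0 /allP lt_v; have lt_c R j : R \in T -> j < size R ->
    cell_lt (nth 0 R j, j) (v, k) by move=> RT jR; apply/lt_v/mem_cells.
case: k lt_v lt_c => [|k] lt_v lt_c.
  have okv : row_ok [:: v] by rewrite /row_ok /= v0.
  case=> <-; move: HT; rewrite /comp_tableau /= okv => /andP[okT ->].
  rewrite okT !andbT /=; apply/allP => R RT; have /(allP okT) okR := RT.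
  have R0 : 0 < size R by case: R okR {RT}.
  rewrite /above /= -nth0; apply/andP; split.
    by have := lt_c R 0 RT R0; rewrite /cell_lt /=; lia.
  apply/triple_ruleP => -[|j] jR _ /=; last by rewrite nth_nil row_ok_pos.
  by have := lt_c R 1 RT jR; rewrite /cell_lt /=; lia.
rewrite /put /= => /put_firstP[T1 [r [T2 [defT rk nk ->]]]].
move: HT; rewrite defT !comp_tableau_cat.
have r0 : r != [::] by case: r rk {defT}.
have hr : head 0 (rcons r v) = head 0 r by case: r r0 {rk defT}.
case/and5P=> ok1 okr ok2 -> /and4P[-> /allP ab1 /allP ab2 ->].
rewrite ok1 ok2 !andbT /=; apply/and3P; split.
- case/and3P: okr => _ pr /(sortedP 0) sr; rewrite /row_ok all_rcons v0 pr /=.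
  rewrite -size_eq0 size_rcons /=; apply/(sortedP 0) => i;
    rewrite size_rcons => ir.
  rewrite !nth_rcons rk; have -> : i < k.+1 by lia.
  have [ik|] := ltnP i.+1 k.+1; first by apply: sr; rewrite rk.
  move=> ik; have -> : i.+1 == k.+1 by lia.
  have := lt_c r i; rewrite defT mem_cat inE eqxx orbT rk => /(_ isT).
  by rewrite /cell_lt /= /geq /=; lia.
- apply/allP => s sT1; have /andP[h1 /triple_ruleP h2] := ab1 s sT1.
  rewrite /above hr h1 /=; apply/triple_ruleP => i; rewrite size_rcons rk => ik.
  rewrite nth_rcons rk; case: ltnP => ik'; first by apply: h2; rewrite rk.
  have -> : i.+1 == k.+1 by lia.
  have {ik ik'}-> : i = k by lia.
  (* A shorter row has no entry in column [k], and 0 < [v]; a longer one has an entry larger than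
     [v] in column [k.+1], so the premise fails. *)
  have := allP nk s sT1; rewrite neq_ltn => /orP[sk|sk].
  + by move=> _; rewrite nth_default //; lia.
  + have := lt_c s k.+1; rewrite defT mem_cat sT1 => /(_ isT sk).
    by rewrite /cell_lt /=; lia.
- apply/allP => s sT2; have /andP[h1 /triple_ruleP h2] := ab2 s sT2.
  have sT : s \in T by rewrite defT mem_cat inE sT2 !orbT.
  rewrite /above hr h1 /=; apply/triple_ruleP => i ik.
  (* The new entry only strengthens the premise in its own column, and in the next column [s] has an
     entry larger than [v]. *)
  have := h2 i ik; rewrite !nth_rcons rk.
  case: (ltnP i.+1 k.+1) => i1; first by have -> : i < k.+1 by lia.
  rewrite nth_default ?rk // => /(_ isT) lt_i.
  move=> _; case: (ltnP i k.+1) => // i2; case: eqP => [ek|_]; last first.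
    exact: leq_ltn_trans lt_i.
  by have := lt_c s i.+1 sT ik; rewrite /cell_lt /=; lia.
Qed.

Lemma puts_rcons w c T : puts (rcons w c) T = obind (put c) (puts w T).
Proof.
elim: w T => [|d w IH] T /=; first by case: (put c T).
by case: (put d T) => //= T'.
Qed.

Lemma puts_comp_tableau w T : sorted cell_lt w -> all (fun c => 0 < c.1) w ->
  puts w [::] = Some T -> comp_tableau T /\ perm_eq (cells T) w.
Proof.
elim/last_ind: w T => [|w [v k] IH] T; first by move=> _ _ [<-].
rewrite !(sorted_pairwise cell_lt_trans) pairwise_rcons all_rcons puts_rcons.
move=> /andP[lt_w sw] /andP[/= v0 pos]; case E: (puts w [::]) => [T0|//] /= ET.
rewrite -(sorted_pairwise cell_lt_trans) in sw.
have [HT0 pw] := IH _ sw pos E; split.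
  by apply: put_comp_tableau HT0 v0 _ ET; rewrite (perm_all _ pw).
rewrite (perm_trans (perm_cells_put ET)) // perm_sym perm_rcons perm_cons.
by rewrite perm_sym.
Qed.

(** This is the cell to remove first: the last one in the order of words, with the smallest entry
    and rightmost among equal ones. *)
Lemma cell_min (s : seq (nat * nat)) : s != [::] ->
  exists2 c, c \in s & forall d, d \in s -> d = c \/ cell_lt d c.
Proof.
elim: s => // c [|c' s] IH _.
  by exists c; rewrite ?inE // => d; rewrite inE => /eqP; left.
have [//|m ms lt_m] := IH; have [lt_cm|nlt] := boolP (cell_lt c m).
  exists m; first by rewrite inE ms orbT.
  by move=> d; rewrite inE => /orP[/eqP ->|/lt_m]; [right|].
exists c; first by rewrite inE eqxx.
move=> d; rewrite inE => /orP[/eqP ->|/lt_m h]; first by left.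
have [mc|mc] : m = c \/ cell_lt m c; last right.
- case: c m nlt {h IH ms lt_m} => [c1 c2] [m1 m2]; rewrite /cell_lt /= => nlt.
  have [[-> ->]|] := eqVneq (m1, m2) (c1, c2); first by left.
  by rewrite xpair_eqE; right; lia.
- by rewrite -mc.
by case: h => [-> //|/cell_lt_trans]; apply.
Qed.

(** Induction on the number of cells: the cell given by [cell_min] ends its row, and inserting it
    again selects the same row. *)
Lemma comp_tableau_puts T : comp_tableau T ->
  exists w, [/\ sorted cell_lt w, all (fun c =>
    0 < c.1) w & puts w [::] = Some T].
Proof.
have [n] := ubnP (size (cells T)); elim: n T => // n IH T sz HT.
have [T0|nT] := eqVneq (cells T) [::].
  exists [::]; split => //=; case: T T0 HT {sz} => // r T; rewrite /cells /=.
  case: r => [|v r] //; by rewrite /comp_tableau /row_ok.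
have [[v k] vk lt_v] := cell_min nT.
have [R [RT kR Rv]] := cellsP vk.
have le_c S j : S \in T -> j < size S ->
    (nth 0 S j = v /\ j = k) \/ cell_lt (nth 0 S j, j) (v, k).
  by move=> ST jS; have [[-> ->]|] := lt_v _ (mem_cells ST jS); [left|right].
have okT : all row_ok T by case/andP: HT.
have okR := allP okT R RT.
(* A further entry to the right would be at most [v] and would come later in the word. *)
have sR : size R = k.+1.
  apply/eqP; rewrite eqn_leq kR andbT leqNgt; apply/negP => kkR.
  have := le_c R k.+1 RT kkR; have := row_ok_dec k okR; rewrite Rv /cell_lt /=.
  lia.
have v0 : 0 < v by rewrite -Rv row_ok_pos.
suff [T' [HT' PT' lt_T']] : exists T', [/\ comp_tableau T',
    put (v, k) T' = Some T & all (cell_lt^~ (v, k)) (cells T')].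
  have pT' := perm_cells_put PT'.
  have [|w [sw pw ew]] := IH T' _ HT'.
    by move: sz; rewrite (perm_size pT').
  exists (rcons w (v, k)); rewrite puts_rcons ew /= PT' all_rcons /= v0 pw.
  split=> //; rewrite (sorted_pairwise cell_lt_trans) pairwise_rcons.
  rewrite -(sorted_pairwise cell_lt_trans) sw andbT.
  by have [_ pp] := puts_comp_tableau sw pw ew; rewrite -(perm_all _ pp).
have lt_T' T' : {subset T' <= T} ->
    (forall S, S \in T' -> k < size S -> nth 0 S k <> v) ->
    all (cell_lt^~ (v, k)) (cells T').
  move=> sT nv; apply/allP => -[u j] /cellsP[S [ST' jS <-]].
  have [[Sv jk]|//] := le_c S j (sT _ ST') jS.
  by case: (nv S ST' _); rewrite -jk.
case/splitPr: RT HT lt_T' le_c {IH sz vk lt_v okT nT} => T1 T2.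
case: k kR Rv sR => [|k] kR Rv sR HT lt_T' le_c.
  (* The first column increases downwards, so a row above [R] would start with an entry smaller than
     [v]. *)
  have [R0 T10] : R = [:: v] /\ T1 = [::].
    split; first by case: R sR Rv {kR HT okR lt_T' le_c} => [|a []] //= _ ->.
    case: T1 HT le_c {lt_T'} => //= S T1 HT le_c.
    have := le_c S 0; rewrite inE eqxx => /(_ isT).
    move: HT; rewrite /comp_tableau /= =>
      /andP[/andP[okS _] /andP[/allP abS _]].
    have := abS R; rewrite mem_cat inE eqxx orbT => /(_ isT)/andP[].
    have S0 : 0 < size S by case: S okS {le_c abS}.
    by rewrite -!nth0 Rv => h _ /(_ S0); rewrite /cell_lt /=; lia.
  move: HT; rewrite R0 T10 comp_tableau_cat =>
    /and5P[_ _ ok2 _ /and4P[pw2 _ /allP ab _]].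
  exists T2; split=> //; first by rewrite /comp_tableau ok2.
  apply: lt_T' => [S ST|S ST S0 Sv]; first by rewrite T10 inE ST orbT.
  by have /andP[] := ab S ST; rewrite -!nth0 Sv /= ltnn.
have [r defR] : exists r, R = rcons r v.
  by case/lastP: R sR Rv {kR okR HT lt_T' le_c} => // r u;
    rewrite size_rcons nth_rcons;
    case=> ->; rewrite ltnn eqxx => ->; exists r.
have rk : size r = k.+1 by move: sR; rewrite defR size_rcons => -[].
have r0 : r != [::] by case: r rk {defR}.
have hr : head 0 R = head 0 r by rewrite defR; case: r r0 {rk defR}.
have nthR i : i <= k -> nth 0 R i = nth 0 r i.
  by move=> ik; rewrite defR nth_rcons rk ltnS ik.
have inT S : S \in T1 ++ T2 -> S \in T1 ++ R :: T2.
  by rewrite !mem_cat inE => /orP[->|->]; rewrite ?orbT.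
move: (HT); rewrite comp_tableau_cat.
case/and5P=> ok1 _ ok2 pw1 /and4P[pw2 /allP ab1 /allP ab2 arel].
(* By the triple condition, a row of this length above [R] would end in an entry smaller than
   [v]. *)
have nk : all (fun s => size s != k.+1) T1.
  apply/allP => S ST; apply/eqP => Sk.
  have /andP[_ /triple_ruleP/(_ k)] := ab1 S ST.
  rewrite sR Rv (nth_default _ (_ : size S <= k.+1)) ?Sk // =>
    /(_ (leqnn _) isT).
  have := le_c S k; rewrite mem_cat ST Sk => /(_ isT (leqnn _)).
  by clear; rewrite /cell_lt /=; lia.
exists (T1 ++ r :: T2); split.
- rewrite comp_tableau_cat ok1 ok2 pw1 pw2 arel !andbT /=; apply/and3P; split.
  + case/and3P: okR; rewrite defR all_rcons => _ /andP[_ pr] /(sortedP 0) sr.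
    rewrite /row_ok r0 pr /=; apply/(sortedP 0) => i ir.
    have := sr i; rewrite size_rcons => /(_ (leqW ir)).
    by rewrite !nth_rcons ir (ltnW ir).
  + apply/allP => S ST; have /andP[h1 /triple_ruleP h2] := ab1 S ST.
    rewrite /above -hr h1 /=; apply/triple_ruleP => i ir.
    have := h2 i; rewrite sR; rewrite rk in ir.
    by rewrite nthR //; apply; rewrite ltnW.
  + apply/allP => S ST; have /andP[h1 /triple_ruleP h2] := ab2 S ST.
    rewrite /above -hr h1 /=; apply/triple_ruleP => i iS.
    have ST' : S \in T1 ++ R :: T2 by rewrite mem_cat inE ST !orbT.
    have [ik|ik] := ltnP i k.
      by have := h2 i iS; rewrite !nthR // ltnW.
    have [ki|ki] := ltnP k i.
      move=> _; rewrite nth_default ?rk //.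
      exact: row_ok_pos (allP ok2 S ST) iS.
    have {ik ki}ik : i = k by apply/eqP; rewrite eqn_leq ik ki.
    (* The entry of [R] in this column is gone, but minimality of [v] supplies the premise of the
       old condition. *)
    rewrite ik in iS * => _; have := h2 k iS; rewrite Rv nthR //; apply.
    by move: (le_c S k.+1 ST' iS); clear; rewrite /cell_lt /=; lia.
- by rewrite /put /= put_first_cat // defR.
rewrite /cells map_cat flatten_cat all_cat /= all_cat.
have tl := lt_T' (T1 ++ T2); rewrite /cells map_cat flatten_cat all_cat in tl.
have /andP[-> ->] /= :
    all (cell_lt^~ (v, k.+1)) (flatten [seq row_cells i | i <- T1]) &&
    all (cell_lt^~ (v, k.+1)) (flatten [seq row_cells i | i <- T2]).
  apply: tl => [S|S]; first exact: inT.
  (* Two rows with [v] in the same column would violate the triple condition, as rows decrease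
     weakly. *)
  rewrite mem_cat => /orP[ST|ST] kS Sv.
    have /andP[_ /triple_ruleP/(_ k)] := ab1 S ST; rewrite sR Rv Sv.
    have := row_ok_dec k (allP ok1 S ST);
      rewrite Sv => h /(_ (leqnn _) (leqnn _)).
    by rewrite ltnNge h.
  have /andP[_ /triple_ruleP/(_ k kS)] := ab2 S ST; rewrite Rv Sv.
  by have := row_ok_dec k okR; rewrite Rv => h /(_ (leqnn _)); rewrite ltnNge h.
rewrite andbT; apply/allP => -[u j]; rewrite mem_row_cells => /andP[jr /eqP <-].
rewrite rk in jr.
have RT : R \in T1 ++ R :: T2 by rewrite mem_cat inE eqxx orbT.
have jR : j < size R by rewrite sR leqW.
have := le_c R j RT jR; rewrite nthR // => -[[_ jk]|//].
by rewrite jk ltnn in jr.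
Qed.

(** * Semistandard augmented fillings *)

(** Extending the first row of length [k] increases the first part [k] of the shape, so words act on
    shapes through the operators t_k. *)
Lemma puts_shape w T : omap shape (puts w T) = grows w (shape T).
Proof.
have put_shape c U : omap shape (put c U) = grow c.2 (shape U).
  rewrite /put /grow; case: c.2 => [|k] //.
  elim: U => //= r U <-; case: eqP => [rk|_]; first by rewrite /= size_rcons rk.
  by case: (put_first _ _ U).
by elim: w T => //= c w IH T; rewrite -put_shape; case: (put c T) => //=.
Qed.

Definition aug_row (F : seq (seq nat)) (i : nat) : seq nat :=
  i.+1 :: nth [::] F i.

Lemma nth_shape0 (F : seq (seq nat)) i : nth 0 (shape F) i =
  size (nth [::] F i).
Proof.
have [iF|iF] := ltnP i (size F); first by rewrite (nth_map [::]).
by rewrite !nth_default // size_map.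
Qed.

Lemma aug_cellE F i k :
  aug_cell (shape F) (i, k) = (i < size F) && (k < size (aug_row F i)).
Proof. by rewrite /aug_cell /= size_map nth_shape0. Qed.

(* The SSAF axioms amount to one rule on pairs of rows that, unlike the triples
   of type A and B, does not refer to the lengths of the two rows. *)
Lemma ssaf_rules (g : seq nat) (F : seq (seq nat)) : is_ssaf g F <->
  [/\ shape F = g, all (all (leq 1)) F,
      forall i, i < size F -> sorted geq (aug_row F i)
    & forall i j, i < j -> j < size F ->
      triple_rule (aug_row F i) (aug_row F j)].
Proof.
split=> [[sF pF rF nF AF BF]|[sF pF rF tF]].
  subst g; split=> // [i iF|i j ij jF].
    apply/(sortedP 0) => k kF; have := rF i k; rewrite aug_cellE iF; exact.
  have iF := ltn_trans ij jF.
  apply/triple_ruleP => k kj; rewrite -!/(entry F (_, _)) => le_q.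
  have [ki|ki] := ltnP k (size (aug_row F i)); last first.
    have -> : entry F (i, k) = 0 by apply: nth_default.
    have := all_nthP [::] pF j jF => /(all_nthP 0); apply.
    by rewrite -ltnS.
  rewrite ltnNge; apply/negP => le_zp.
  have neq_zp : entry F (j, k.+1) <> entry F (i, k).
    apply: nF; rewrite ?aug_cellE ?jF ?iF //; first by case=> _ /eqP;
      rewrite -addn1 -{2}[k]addn0 eqn_add2l.
    by rewrite /attacks /= eqxx ij orbT.
  (* If row [i] is at least as long as row [j], the negated rule orders the type A triple as a < b <
     c, which is no inversion triple. *)
  have [le_ji|lt_ij] := leqP (size (nth [::] F j)) (size (nth [::] F i)).
    have ki1 : k.+1 < size (aug_row F i) by apply: leq_trans kj _.
    have neq_zq : entry F (i, k.+1) <> entry F (j, k.+1).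
      apply: nF; rewrite ?aug_cellE ?jF ?iF //; last by rewrite /attacks eqxx.
      by case=> e; rewrite e ltnn in ij.
    have := AF i j k ij; rewrite !nth_shape0 !aug_cellE iF jF =>
      /(_ le_ji ki1 kj).
    rewrite /inversion_triple /entry_lt; lia.
  (* If row [j] is longer, type B triples carry the strict inequality from the basement to the
     right. *)
  have strong l : l < size (aug_row F i) -> entry F (i, l) < entry F (j, l.+1).
    elim: l => [|l IH] li.
      have j1 : 0.+1 < size (aug_row F j) by rewrite /= in li *; lia.
      have neq : entry F (j, 1) <> entry F (i, 0).
        apply: nF; rewrite ?aug_cellE ?jF ?iF //; by rewrite /attacks /= ij.
      have := BF i j 0 ij; rewrite !nth_shape0 !aug_cellE iF jF.
      move=> /(_ lt_ij li j1); move: neq.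
      by rewrite /inversion_triple /entry_lt /read_before /entry /=; lia.
    have lj1 : l.+2 < size (aug_row F j) by rewrite /= in li *; lia.
    have lj2 : l.+1 < size (aug_row F j) by rewrite ltnW.
    have h1 := IH (ltnW li).
    have h2 := rF i l; rewrite aug_cellE iF in h2; have {}h2 := h2 li.
    have h3 := rF j l.+1; rewrite aug_cellE jF in h3; have {}h3 := h3 lj1.
    have neq : entry F (j, l.+2) <> entry F (i, l.+1).
      apply: nF; rewrite ?aug_cellE ?jF ?iF //.
        by case=> _ /eqP; rewrite eqn_leq ltnn.
      by rewrite /attacks /= eqxx ij orbT.
    have := BF i j l.+1 ij; rewrite !nth_shape0 !aug_cellE iF jF.
    move=> /(_ lt_ij li lj1); rewrite /inversion_triple /entry_lt.
    move: h1 h2 h3 neq; rewrite /read_before /=; lia.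
  by have := strong k ki; rewrite ltnNge le_zp.
have dec i k : i < size F -> entry F (i, k.+1) <= entry F (i, k).
  move=> iF; have /(sortedP 0) h := rF i iF.
  have [/h //|ki] := ltnP k.+1 (size (aug_row F i)).
  by have -> : entry F (i, k.+1) = 0 by apply: nth_default.
have rule i j k : i < j -> j < size F -> k.+1 < size (aug_row F j) ->
    entry F (i, k.+1) <= entry F (j, k.+1) ->
      entry F (i, k) < entry F (j, k.+1).
  by move=> ij jF; apply: (triple_ruleP _ _ (tF i j ij jF)).
subst g; split=> //.
- by move=> i k; rewrite aug_cellE => /andP[iF _]; apply: dec.
(* Equal entries in attacking cells, not both in the basement, satisfy the premise of the rule,
   while its conclusion fails because rows decrease. *)
- have diag i j k : i < j -> j < size F -> k.+1 < size (aug_row F j) ->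
      entry F (i, k) <> entry F (j, k.+1).
    move=> ij jF kj e; have := rule i j k ij jF kj; rewrite -e ltnn.
    by rewrite dec ?(ltn_trans ij) // => /(_ isT).
  have colm i j k : i < j -> j < size F -> k < size (aug_row F j) ->
      entry F (i, k) <> entry F (j, k).
    case: k => [|k] ij jF kj e; first by move: e; rewrite /entry /=; lia.
    have := rule i j k ij jF kj; rewrite e leqnn => /(_ isT).
    by rewrite ltnNge -e dec // (ltn_trans ij).
  move=> [i k] [j l]; rewrite !aug_cellE => /andP[iF ki] /andP[jF lj] ne.
  rewrite /attacks /= => /orP[/eqP kl|/andP[/eqP kl ji]].
    subst l; have [ij|ij|ij] := ltngtP i j; [exact: colm | | by subst j].
    by move=> e; case: (colm j i k).
  by subst k => e; case: (diag j i l).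
- move=> i j k ij _; rewrite !aug_cellE => /andP[iF ki] /andP[jF kj].
  have := rule i j k ij jF kj; have := dec i k iF.
  by rewrite /inversion_triple /entry_lt /read_before /=; lia.
move=> i j k ij; rewrite !nth_shape0 !aug_cellE =>
  lt_ij /andP[iF ki] /andP[jF kj].
(* Induction from the end of row [i], past which the entry reads 0: each strict inequality yields
   the premise of the rule one column further left. *)
have strong l d : l + d = size (nth [::] F i) ->
  entry F (i, l) < entry F (j, l.+1).
  elim: d l => [|d IH] l ld; (apply: rule => //; first by rewrite /=; lia).
    by rewrite {1}/entry /= nth_default // -ld addn0.
  by apply: leq_trans (ltnW (IH l.+1 _)) (dec _ _ _); rewrite ?addSnnS.
have := strong k (size (nth [::] F i) - k); rewrite subnKC // => /(_ erefl).
have := dec j k jF.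
by rewrite /inversion_triple /entry_lt /read_before /=; lia.
Qed.

(** * SSAFs and composition tableaux *)

Definition nonempty_rows (F : seq (seq nat)) : seq (seq nat) :=
  [seq r <- F | r != [::]].

(** A nonempty row of an SSAF starts with its basement entry, so the row [r] must get the number
    [head 0 r]; empty rows fill the gaps. The argument [i] counts the rows already placed. *)
Fixpoint spread (i : nat) (T : seq (seq nat)) : seq (seq nat) :=
  if T is r :: T' then
    nseq (head 0 r - i.+1) [::] ++ r :: spread (head 0 r) T'
  else [::].

Lemma nonempty_rows_spread i T : all row_ok T -> nonempty_rows (spread i T) = T.
Proof.
elim: T i => //= r T IH i /andP[/and3P[r0 _ _] okT].
rewrite /nonempty_rows filter_cat /= r0.
have -> : [seq r <- nseq (head 0 r - i.+1) [::] | r != [::]] =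
  [::] :> seq (seq nat).
  by elim: (_ - _).
by congr (_ :: _); apply: IH.
Qed.

Lemma collapse_shape F : collapse (shape F) = shape (nonempty_rows F).
Proof.
rewrite /collapse /shape filter_map /nonempty_rows; congr map.
by apply: eq_filter => r /=; rewrite lt0n size_eq0.
Qed.

Lemma spread_head i T : comp_tableau T -> (forall r, r \in T -> i < head 0 r) ->
  forall j, nth [::] (spread i T) j != [::] ->
    head 0 (nth [::] (spread i T) j) = (i + j).+1.
Proof.
elim: T i => [|r T IH] i /=; first by move=> _ _ j; rewrite nth_nil.
move=> /andP[/= /andP[_ okT] /andP[/allP ab pw]] gt_i j.
have lt_r : i < head 0 r by apply: gt_i; rewrite inE eqxx.
rewrite nth_cat size_nseq nth_nseq; case: ltnP => [_ //|ji].
have [j0|j0] := posnP (j - (head 0 r - i.+1)).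
  by rewrite j0 /= => _; lia.
rewrite -(prednK j0) /= => ne; rewrite IH //; first by lia.
  by rewrite /comp_tableau okT.
by move=> s /ab/andP[].
Qed.

Lemma comp_tableau_pos T r : comp_tableau T -> r \in T -> 0 < head 0 r.
Proof.
move=> /andP[/allP okT _] /okT okr; rewrite -nth0; apply: row_ok_pos => //.
by case: r okr.
Qed.

Lemma pairwise_nonempty_rows (F : seq (seq nat)) (e : rel (seq nat)) :
  pairwise e (nonempty_rows F) =
  pairwise (fun r r' => (r != [::]) ==> (r' != [::]) ==> e r r') F.
Proof.
elim: F => //= r F IH; case: (r != [::]) => /=; last by rewrite IH all_predT.
rewrite IH; congr (_ && _); rewrite all_filter; exact: eq_all.
Qed.

(** In the first column the rule compares row numbers, for an empty row above it holds as entries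
    are positive, and elsewhere it is the triple condition of the tableau. *)
Lemma spread_ssaf T : comp_tableau T ->
  is_ssaf (shape (spread 0 T)) (spread 0 T).
Proof.
move=> HT; set F := spread 0 T; apply/ssaf_rules.
have hF j : nth [::] F j != [::] -> head 0 (nth [::] F j) = j.+1.
  by apply: spread_head => // r; apply: comp_tableau_pos.
have /andP[okT pwT] := HT.
have okF r : r \in F -> r != [::] -> row_ok r.
  move=> rF r0; apply: (allP okT); rewrite -(nonempty_rows_spread 0 okT).
  by rewrite mem_filter r0.
have posF : all (all (leq 1)) F.
  apply/allP => r rF; have [->//|/(okF _ rF)] := eqVneq r [::].
  by case/and3P.
split=> // [i iF|i j ij jF].
  have := mem_nth [::] iF; rewrite /aug_row; have := hF i.
  case E: (nth [::] F i) => [//|v r] /(_ isT) /= -> rF.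
  by have /and3P[_ _ /= ->] := okF _ rF isT; rewrite andbT /geq /=.
have iF := ltn_trans ij jF.
apply/triple_ruleP => -[|k] kj le.
  have : nth [::] F j != [::] by move: kj; rewrite /aug_row; case: nth.
  by move=> /hF; rewrite /aug_row /= nth0 => ->.
have jn : nth [::] F j != [::] by move: kj; rewrite /aug_row; case: nth.
have [i0|inn] := eqVneq (nth [::] F i) [::].
  rewrite /aug_row i0 /= nth_nil; apply: row_ok_pos; last exact: kj.
  by apply: okF jn; rewrite mem_nth.
have : above (nth [::] F i) (nth [::] F j).
  move: pwT; rewrite -(nonempty_rows_spread 0 okT) pairwise_nonempty_rows.
  by move=> /(pairwiseP [::])/(_ i j iF jF ij); rewrite inn jn.
by case/andP=> _ /triple_ruleP; apply.
Qed.

Lemma last_spread i T : all row_ok T -> 0 < last 1 (shape (spread i T)).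
Proof.
elim: T i => //= r T IH i /andP[/and3P[r0 _ _] okT].
rewrite /shape map_cat last_cat /=; have := IH (head 0 r) okT.
by case: (spread _ T) => //= _; rewrite lt0n size_eq0.
Qed.

Lemma spread_nonempty_rows i F : 
  (forall j, nth [::] F j != [::] -> head 0 (nth [::] F j) = (i + j).+1) ->
  0 < last 1 (shape F) -> spread i (nonempty_rows F) = F.
Proof.
elim: F i => //= r F IH i hF lF.
have hF' j : nth [::] F j != [::] -> head 0 (nth [::] F j) = (i.+1 + j).+1.
  by move=> jn; rewrite addSnnS; apply: (hF j.+1).
have [r0|r0] /= := eqVneq r [::].
  have lF' : 0 < last 1 (shape F) by case: F lF {IH hF hF'} => //=; rewrite r0.
  have := IH i.+1 hF' lF'.
  case E: (nonempty_rows F) => [|s T] /= eF.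
    by move: lF; rewrite -eF r0.
  have /andP[s0 sF] : (s != [::]) && (s \in F).
    by rewrite -(mem_filter (fun s =>
      s != [::])) -/(nonempty_rows F) E inE eqxx.
  have sh := hF' (index s F); rewrite nth_index // in sh.
  rewrite (_ : head 0 s - i.+1 = (head 0 s - i.+2).+1) /= ?eF ?r0 //.
  by rewrite sh //; lia.
have := hF 0 r0; rewrite addn0 /= => hr.
rewrite hr subnn /=; congr (_ :: _); apply: IH => //.
by case: F lF {hF hF'}.
Qed.

Lemma ssaf_nonempty_rows g F : is_ssaf g F -> 0 < last 1 g ->
  spread 0 (nonempty_rows F) = F /\ comp_tableau (nonempty_rows F).
Proof.
case/ssaf_rules=> <- pF rF tF lF.
have oF j : nth [::] F j != [::] -> j < size F.
  by rewrite ltnNge; apply: contra => /(nth_default [::]) ->.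
have hF j : nth [::] F j != [::] -> head 0 (nth [::] F j) = j.+1.
  elim/ltn_ind: j => j IH jn; have jF := oF j jn.
  have s1 : 1 < size (aug_row F j) by rewrite /= ltnS lt0n size_eq0.
  have e1 : head 0 (nth [::] F j) = nth 0 (aug_row F j) 1 by rewrite /= nth0.
  have le_j : nth 0 (aug_row F j) 1 <= j.+1 by have /(sortedP 0)/(_ 0 s1) :=
    rF j jF.
  apply/eqP; rewrite e1 eqn_leq le_j /=.
  rewrite ltnNge; apply/negP => le'.
  set v := nth 0 (aug_row F j) 1 in le' le_j e1.
  have v0 : 0 < v.
    rewrite -e1 -nth0; apply: (all_nthP 0 (all_nthP [::] pF j jF)).
    by rewrite lt0n size_eq0.
  (* A first entry [v] other than the basement entry would break the rule against the row with
     basement entry [v], which lies above. *)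
  have vj : v.-1 < j by rewrite prednK.
  have h := triple_ruleP _ _ (tF v.-1 j vj jF) 0 s1.
  rewrite -/v [nth 0 _ 0]/= prednK // ltnn in h.
  suff : nth 0 (aug_row F v.-1) 1 <= v by move=> /h.
  rewrite /=; have [->//|vn] := eqVneq (nth [::] F v.-1) [::].
  by rewrite nth0 IH // prednK.
split; first exact: spread_nonempty_rows.
apply/andP; split.
  apply/allP => r; rewrite mem_filter => /andP[r0 rF'].
  rewrite /row_ok r0 (allP pF) //=; have := rF (index r F).
  by rewrite index_mem /aug_row nth_index // => /(_ rF')/path_sorted.
rewrite pairwise_nonempty_rows; apply/(pairwiseP [::]) => i j iF jF ij.
apply/implyP => inn; apply/implyP => jn; rewrite /above !hF // ltnS ij /=.
have /triple_ruleP h := tF i j ij jF.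
by apply/triple_ruleP => k kj; apply: (h k.+1).
Qed.

(** * The bijection between words and SSAFs *)

Definition word_ok (w : seq (nat * nat)) : bool :=
  sorted cell_lt w && all (fun c => 0 < c.1) w.

Definition content (w : seq (nat * nat)) : {cmonom nat} :=
  \big[mmul/mone]_(c <- w) ucm c.1.-1.

Definition ssaf_of (w : seq (nat * nat)) : seq (seq nat) :=
  oapp (spread 0) [::] (puts w [::]).

Lemma grows_puts w a : grows w [::] = Some a ->
  exists2 T, puts w [::] = Some T & shape T = a.
Proof. by rewrite -(puts_shape w [::]); case: puts => //= T [<-]; exists T. Qed.

Lemma flatten_nonempty_rows F : flatten (nonempty_rows F) = flatten F.
Proof. by elim: F => //= -[|v r] F IH /=; rewrite IH. Qed.

Lemma cells_flatten T : map fst (cells T) = flatten T.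
Proof.
rewrite /cells map_flatten -map_comp; congr flatten; rewrite -[RHS]map_id.
by apply: eq_map => r /=; rewrite -/unzip1 unzip1_zip // size_iota.
Qed.

Lemma ssaf_of_word w a : word_ok w -> grows w [::] = Some a ->
  [/\ is_ssaf (shape (ssaf_of w)) (ssaf_of w), 0 < last 1 (shape (ssaf_of w)),
      collapse (shape (ssaf_of w)) = a & weight (ssaf_of w) = content w].
Proof.
move=> /andP[sw pw] /grows_puts[T ET <-]; rewrite /ssaf_of ET /=.
have [HT pT] := puts_comp_tableau sw pw ET; have /andP[okT _] := HT.
split; [exact: spread_ssaf | exact: last_spread | |].
  by rewrite collapse_shape nonempty_rows_spread.
rewrite /weight -flatten_nonempty_rows nonempty_rows_spread // -cells_flatten.
by rewrite big_map; apply: perm_big.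
Qed.

Lemma ssaf_word g F : is_ssaf g F -> 0 < last 1 g ->
  exists w, [/\ word_ok w, grows w [::] = Some (collapse g) & ssaf_of w = F].
Proof.
move=> HF lg; have [eF HT] := ssaf_nonempty_rows HF lg.
have [w [sw pw ew]] := comp_tableau_puts HT; exists w.
rewrite /word_ok sw pw /ssaf_of ew; split=> //.
rewrite -(puts_shape w [::]) ew /= -collapse_shape.
by case: HF => ->.
Qed.

(** Deleting the empty rows recovers the tableau, whose cells in the order [cell_lt] are the
    word. *)
Lemma ssaf_of_inj w w' a a' : word_ok w -> word_ok w' ->
  grows w [::] = Some a -> grows w' [::] = Some a' ->
  ssaf_of w = ssaf_of w' -> w = w'.
Proof.
move=> /andP[sw pw] /andP[sw' pw'] /grows_puts[T ET _] /grows_puts[T' ET' _].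
rewrite /ssaf_of ET ET' /= => eT.
have [/andP[okT _] pT] := puts_comp_tableau sw pw ET.
have [/andP[okT' _] pT'] := puts_comp_tableau sw' pw' ET'.
have {}eT : T = T'.
  by rewrite -(nonempty_rows_spread 0 okT) eT nonempty_rows_spread.
apply: (irr_sorted_eq cell_lt_trans cell_lt_irr sw sw'); apply: perm_mem.
by rewrite (perm_trans _ pT') // perm_sym -eT.
Qed.

(** * Strips *)

(** The height of column [k] in the Ferrers diagram of the sorted parts, with columns numbered from
    0. *)
Definition col_height (k : nat) (b : seq nat) : nat := count (fun p => k < p) b.

Fixpoint shrinks (L : seq nat) (b : seq nat) : option (seq nat) :=
  if L is k :: L' then obind (shrinks L') (shrink k b) else Some b.

(** The columns of the cells of lambda(b)/lambda(a), with multiplicity, in the order of [L]. The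
    subtraction truncates where [a] is the higher one. *)
Definition col_diff (L a b : seq nat) : seq nat :=
  flatten [seq nseq (col_height k b - col_height k a) k | k <- L].

Lemma col_heightS k b : col_height k b = col_height k.+1 b + count_mem k.+1 b.
Proof.
elim: b => //= x b; rewrite /col_height /= => ->.
by case: (ltngtP x k.+1) => h; lia.
Qed.

Lemma col_height_mono k b : col_height k.+1 b <= col_height k b.
Proof. by rewrite (col_heightS k) leq_addr. Qed.

Lemma shrink_height k b c j : shrink k b = Some c ->
  col_height j b = col_height j c + (j == k).
Proof.
rewrite /col_height; elim: b c => //= x b IH c; case E: (shrink k b) => [d|].
  by move=> [<-] /=; rewrite (IH d) // addnA.
case: eqP => // -> [<-].
by case: k {IH E} => [|k] /=; case: (ltngtP j _) => //; lia.
Qed.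

Lemma shrinks_height L b c j : shrinks L b = Some c ->
  col_height j b = col_height j c + count_mem j L.
Proof.
elim: L b => [|k L IH] b /=; first by move=> [->]; rewrite addn0.
case E: (shrink k b) => [d|] //= /IH hd; rewrite (shrink_height j E) hd.
by rewrite (eq_sym k) -addnA [X in _ + X]addnC.
Qed.

Lemma shrinks_nseq e k L b : e <= count_mem k.+1 b ->
  exists2 c, shrinks (nseq e k ++ L) b = shrinks L c &
    forall j, col_height j b = col_height j c + e * (j == k).
Proof.
elim: e b => [|e IH] b /=; first by exists b => // j; rewrite addn0.
move=> lt_e; have /shrink_Some[d Ed] : k.+1 \in b.
  by rewrite -has_pred1 has_count; apply: leq_ltn_trans lt_e.
have [|c Ec hc] := IH d; first by move: lt_e; rewrite (count_shrink Ed).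
exists c => [|j]; first by rewrite Ed.
by rewrite (shrink_height j Ed) hc mulSn; lia.
Qed.

Lemma count_col_diff L a b k : uniq L ->
  count_mem k (col_diff L a b) =
    if k \in L then col_height k b - col_height k a else 0.
Proof.
rewrite /col_diff; elim: L => //= l L IH /andP[lL uL].
rewrite count_cat IH // inE count_nseq /= eq_sym.
have [->|_] /= := eqVneq k l; first by rewrite (negbTE lL) mul1n addn0.
by case: ifP; rewrite mul0n.
Qed.

Lemma eq_col_diff L a b b' : {in L, forall k, col_height k b =
  col_height k b'} ->
  col_diff L a b = col_diff L a b'.
Proof. by move=> h; congr flatten; apply/eq_in_map => k /h ->. Qed.

Lemma rev_col_diff L a b : rev (col_diff L a b) = col_diff (rev L) a b.
Proof.
rewrite /col_diff rev_flatten -map_comp map_rev; congr (flatten (rev _)).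
by apply: eq_map => k /=; rewrite rev_nseq.
Qed.

Lemma sorted_col_diff m n a b : sorted leq (col_diff (iota m n) a b).
Proof.
rewrite (sorted_pairwise leq_trans) /col_diff; elim: n m => //= n IH m.
rewrite pairwise_cat IH andbT; apply/andP; split; last first.
  by elim: (_ - _) => //= e ->; rewrite andbT; apply/allP => i /nseqP[->].
apply/allrelP => i j /nseqP[-> _] /flattenP[_ /mapP[k + ->]].
by rewrite mem_iota => /andP[mk _] /nseqP[-> _]; apply: ltnW.
Qed.

(** * Strip operators on delta functions *)

Section PullBackDelta.
Local Open Scope ring_scope.
Variable M : zmodType.

Definition delta (a : seq nat) (u : M) (b : seq nat) : M :=
  if b == a then u else 0.

Lemma shrink_stripE (y : {additive M -> M}) N (f : seq nat -> M) :
  shrink_strip y N f = foldr (fun k => step (shrink k) y) f (rev (iota 0 N)).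
Proof.
elim: N => // N IH; rewrite [LHS]/= IH -[in RHS](addn1 N) iotaD rev_cat //.
Qed.

Lemma shrink_vstripE (y : {additive M -> M}) N (f : seq nat -> M) :
  shrink_vstrip y N f = foldr (shrink_geom y) f (iota 0 N).
Proof.
elim: N f => // N IH f.
by rewrite [LHS]/= IH -[in RHS](addn1 N) iotaD foldr_cat.
Qed.

(** The operator r_k changes the height of column [k] only. Hence the heights of [a] and [b] decide
    which factors act by r_k, and at most one term of the expanded product survives. *)
Lemma hstrip_delta (y : {additive M -> M}) L a u b : uniq L ->
  foldr (fun k => step (shrink k) y) (delta a u) L b =
    if all (fun k => col_height k b <= (col_height k a).+1)%N L &&
       (shrinks (col_diff L a b) b == Some a)
    then iter (size (col_diff L a b)) y u else 0.
Proof.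
elim: L b => [|k L IH] b //= /andP[kL uL]; rewrite /step.
set g := foldr _ _ L; have g0 c : col_height k c <> col_height k a -> g c = 0.
  move=> ne; rewrite /g IH //; case: ifP => // /andP[_ /eqP/(shrinks_height k)].
  by rewrite count_col_diff // (negbTE kL) addn0.
have gS c : shrink k b = Some c ->
  g c = if all (fun k => col_height k b <= (col_height k a).+1)%N L &&
       (shrinks (col_diff L a b) c == Some a)
    then iter (size (col_diff L a b)) y u else 0.
  move=> Ec; rewrite /g IH //;
    have hc j : j \in L -> col_height j c = col_height j b.
    move=> jL; rewrite (shrink_height j Ec); case: eqP => [jk|_];
      last by rewrite addn0.
    by move: kL; rewrite -jk jL.
  rewrite (eq_col_diff _ hc); congr (if _ && _ then _ else _).
  by apply: eq_in_all => j /hc ->.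
have [le_d|lt_d] := leqP (col_height k b) (col_height k a).
  rewrite (leqW le_d) /=.
  have -> : col_diff (k :: L) a b = col_diff L a b.
    by rewrite /col_diff /=; move: le_d; rewrite -subn_eq0 => /eqP ->.
  rewrite -IH // -/g -[X in _ = X]addr0; congr (_ + _).
  case E: (shrink k b) => [c|] /=; last exact: raddf0.
  rewrite g0 ?raddf0 //; move: (shrink_height k E); rewrite eqxx; lia.
rewrite g0 ?add0r; last by lia.
have -> : col_diff (k :: L) a b =
    nseq (col_height k b - col_height k a)%N k ++ col_diff L a b by [].
have [le1|lt1] := leqP (col_height k b) (col_height k a).+1.
  have -> : (col_height k b - col_height k a = 1)%N by lia.
  rewrite /=; case E: (shrink k b) => [c|] /=; last by rewrite andbF raddf0.
  by rewrite (gS c E); case: ifP => // _; exact: raddf0.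
rewrite /=; case E: (shrink k b) => [c|] /=; last exact: raddf0.
by rewrite g0 ?raddf0 //; move: (shrink_height k E); rewrite eqxx; lia.
Qed.

(** As for [hstrip_delta], except that the difference of heights now tells how often r_k is used. *)
Lemma vstrip_delta (y : {additive M -> M}) L a u b : uniq L ->
  foldr (shrink_geom y) (delta a u) L b =
    if shrinks (col_diff L a b) b == Some a
    then iter (size (col_diff L a b)) y u else 0.
Proof.
elim: L b => [|k L IH] b //= /andP[kL uL].
set g := foldr _ _ L; have g0 c : col_height k c <> col_height k a -> g c = 0.
  move=> ne; rewrite /g IH //; case: ifP => // /eqP/(shrinks_height k).
  by rewrite count_col_diff // (negbTE kL) addn0.
have [n] := ubnP (count_mem k.+1 b); elim: n b => // n IHn b lt_n.
rewrite shrink_geomE.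
have [le_d|lt_d] := leqP (col_height k b) (col_height k a).
  have -> : col_diff (k :: L) a b = col_diff L a b.
    by rewrite /col_diff /=; move: le_d; rewrite -subn_eq0 => /eqP ->.
  rewrite -IH // -/g -[X in _ = X]addr0; congr (_ + _).
  case E: (shrink k b) => [c|] /=; last exact: raddf0.
  have hk := shrink_height k E; rewrite eqxx in hk.
  rewrite IHn; last by move: lt_n; rewrite (count_shrink E).
  case: ifP => [/eqP/(shrinks_height k)|_]; last exact: raddf0.
  rewrite count_col_diff /= ?kL // inE eqxx /=; lia.
rewrite g0 ?add0r; last by lia.
have cE c : shrink k b = Some c ->
  col_diff (k :: L) a b = k :: col_diff (k :: L) a c.
  move=> Ec; have hk := shrink_height k Ec; rewrite eqxx in hk.
  rewrite [LHS]/col_diff [in RHS]/col_diff /=.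
  have -> : (col_height k b - col_height k a =
    (col_height k c - col_height k a).+1)%N.
    by lia.
  rewrite /=; congr (_ :: _ ++ _); apply: eq_col_diff => j jL.
  rewrite (shrink_height j Ec); case: eqP => [jk|_]; last by rewrite addn0.
  by move: kL; rewrite -jk jL.
case E: (shrink k b) => [c|] /=.
  rewrite (cE c E) /= E /= IHn; last by move: lt_n; rewrite (count_shrink E).
  by case: ifP => // _; exact: raddf0.
rewrite raddf0 (_ : col_diff (k :: L) a b =
  nseq (col_height k b - col_height k a)%N k ++ col_diff L a b) //.
by rewrite -(subnSK lt_d) /= E.
Qed.

End PullBackDelta.

(** * The operators [rem_part] and [shrink] *)

Lemma collapse_id b : is_composition b -> collapse b = b.
Proof. by move=> hb; apply/all_filterP. Qed.

Lemma last_occurrence (s : nat) a : s \in a ->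
  exists a1 a2, a = a1 ++ s :: a2 /\ s \notin a2.
Proof.
elim: a => //= x a IH; have [/IH[a1 [a2 [-> sa2]]] _|sa] := boolP (s \in a).
  by exists (x :: a1), a2.
by rewrite inE (negbTE sa) orbF => /eqP sx; exists [::], a; rewrite sx in sa *.
Qed.

Lemma rem_part_cat s a1 a2 : s \notin a2 ->
  rem_part s (a1 ++ s :: a2) = a1 ++ s.-1 :: a2.
Proof.
move=> sa2; rewrite /rem_part mem_cat inE eqxx orbT.
have -> : rev (a1 ++ s :: a2) = rev a2 ++ s :: rev a1.
  by rewrite rev_cat rev_cons cat_rcons.
rewrite index_cat mem_rev (negbTE sa2) /= eqxx addn0.
have set_mid (p q : seq nat) x y : set_nth 0 (p ++ x :: q) (size p) y = p ++
  y :: q.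
  by elim: p => //= z p ->.
by rewrite set_mid rev_cat rev_cons !revK cat_rcons.
Qed.

Lemma shrink_cat k a1 a2 : k.+1 \notin a2 ->
  shrink k (a1 ++ k.+1 :: a2) = Some (a1 ++ if k is 0 then a2 else k :: a2).
Proof.
move=> ka2; elim: a1 => [|x a1 IH] /=; first by rewrite shrink_None // eqxx.
by rewrite IH.
Qed.

Lemma mem_collapse k b : (k.+1 \in collapse b) = (k.+1 \in b).
Proof. by rewrite mem_filter. Qed.

(** The zero that [rem_part] may leave is deleted by [shrink] at once; collapsing before or after
    gives the same, as only positive parts are ever decreased. *)
Lemma shrink_rem_part k b c : shrink k (collapse b) = Some c ->
  collapse (rem_part k.+1 b) = c.
Proof.
have [kb|kb] := boolP (k.+1 \in b); last by rewrite shrink_None // mem_collapse.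
have [a1 [a2 [-> ka2]]] := last_occurrence kb.
rewrite rem_part_cat // /collapse !filter_cat /= shrink_cat ?mem_collapse //.
by case=> <-; case: k {kb ka2}.
Qed.

Lemma shrinks_rem_part L b c : shrinks L (collapse b) = Some c ->
  collapse (foldl (fun b m => rem_part m b) b (map S L)) = c.
Proof.
elim: L b => [|k L IH] b /=; first by case.
case E: (shrink k _) => [d|] //=; rewrite -(shrink_rem_part E).
exact: IH.
Qed.

(** * Ferrers diagrams and column heights *)

(** Conjugation: the numbers [col_height k g] are the parts of the conjugate partition. *)
Lemma nth_sort_partition g i k :
  (k < nth 0 (sort_partition g) i) = (i < col_height k g).
Proof.
have -> : col_height k g = col_height k (sort_partition g).
  rewrite /col_height /sort_partition count_sort /collapse count_filter.
  by apply: eq_count => p /=; lia.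
have : sorted geq (sort_partition g) by apply: sort_sorted => m n;
  apply: leq_total.
rewrite /col_height (sorted_pairwise); last by move=> a b c /= ab ca;
  apply: leq_trans ab.
elim: (sort_partition g) i => [|x l IH] i /=; first by rewrite nth_nil.
move=> /andP[/allP xl pl]; have [kx|xk] := ltnP k x.
  by case: i => //= i; rewrite IH.
have -> : count (fun p => k < p) l = 0.
  apply/eqP; rewrite -leqn0 leqNgt -has_count; apply/hasPn => p /xl /= px.
  by rewrite -leqNgt (leq_trans px).
rewrite addn0 ltn0 ltnNge; apply/negbTE; rewrite negbK; case: i => //= i.
have [il|il] := ltnP i (size l); last by rewrite nth_default.
by apply: leq_trans xk; apply: xl; rewrite mem_nth.
Qed.

Lemma mem_ferrers l i j : ((i, j) \in ferrers l) = (0 < j <= nth 0 l i).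
Proof.
apply/allpairsPdep/idP => [[i' [j' [+ + [-> ->]]]]|jl].
  by rewrite !mem_iota add1n ltnS.
exists i, j; rewrite !mem_iota add1n ltnS; split=> //=.
by apply: contraTT jl; rewrite -leqNgt => ?; rewrite nth_default // leqn0; lia.
Qed.

Lemma mem_skew a b i k :
  ((i, k.+1) \in skew (sort_partition b) (sort_partition a)) =
  (col_height k a <= i < col_height k b).
Proof.
by rewrite mem_filter !mem_ferrers /= !nth_sort_partition -leqNgt.
Qed.

Lemma skew_col_gt0 la mu i j : (i, j) \in skew la mu -> 0 < j.
Proof. by rewrite mem_filter !mem_ferrers => /andP[_ /andP[]]. Qed.

Lemma included_height a b :
  included (sort_partition a) (sort_partition b) <->
  forall k, col_height k a <= col_height k b.
Proof.
split=> [h k|h i].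
  have [//|lt_ba] := leqP (col_height k a) (col_height k b).
  have := h (col_height k b).
  rewrite -nth_sort_partition in lt_ba => le.
  by have := leq_trans lt_ba le; rewrite nth_sort_partition ltnn.
case E: (nth 0 (sort_partition a) i) => [//|k].
by rewrite nth_sort_partition (leq_trans _ (h k)) // -nth_sort_partition E.
Qed.

Lemma horizontal_height a b :
  horizontal_strip (skew (sort_partition b) (sort_partition a)) <->
  forall k, col_height k b <= (col_height k a).+1.
Proof.
split=> [h k|h [i j] [i' j'] s s' /= e].
  rewrite leqNgt; apply/negP => lt2.
  set d := skew _ _ in h.
  have d1 : (col_height k a, k.+1) \in d by rewrite mem_skew; lia.
  have d2 : ((col_height k a).+1, k.+1) \in d by rewrite mem_skew; lia.
  by case: (h _ _ d1 d2 erefl); lia.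
subst j'; have := skew_col_gt0 s; case: j s s' => // k.
by rewrite !mem_skew => s s' _; have hk := h k; congr (_, _); lia.
Qed.

Lemma vertical_height a b :
  vertical_strip (skew (sort_partition b) (sort_partition a)) <->
  forall k, col_height k.+1 b <= col_height k a.
Proof.
split=> [h k|h [i j] [i' j'] s s' /= e].
  rewrite leqNgt; apply/negP => lt2.
  have ma := col_height_mono k a; have mb := col_height_mono k b.
  set d := skew _ _ in h.
  (* The row just below column [k] of lambda(a) would contain two cells of the skew diagram. *)
  have d1 : (col_height k a, k.+1) \in d by rewrite mem_skew; lia.
  have d2 : (col_height k a, k.+2) \in d by rewrite mem_skew; lia.
  by case: (h _ _ d1 d2 erefl); lia.
subst i'; wlog jj' : j j' s s' / j <= j'.
  by move=> hw; have [/hw ->//|/ltnW/hw ->] := leqP j j'.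
move: jj'; rewrite leq_eqVlt => /orP[/eqP -> //|lt_jj'].
case: j s lt_jj' => [/skew_col_gt0 //|k s]; case: j' s' => // k' s' lt_k.
have mono m d : col_height (m + d) b <= col_height m b.
  by elim: d => [|d IH];
    rewrite ?addn0 // addnS (leq_trans (col_height_mono _ _)).
have := mono k.+1 (k' - k.+1); rewrite subnKC // => le1.
move: s s'; rewrite !mem_skew; have := h k; lia.
Qed.

Lemma count_range c d n : count (fun i => c <= i < d) (iota 0 n) = minn d n - c.
Proof.
elim: n => [|n IH]; first by rewrite minn0.
rewrite -addn1 iotaD count_cat IH add0n /= addn0.
by case: leqP => /=; case: ltnP => /=; lia.
Qed.

Lemma count_skew_cols a b s :
  count_mem s (strip_colmset (skew (sort_partition b) (sort_partition a))) =
  if s is k.+1 then col_height k b - col_height k a else 0.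
Proof.
case: s => [|k].
  apply/count_memPn/negP => /mapP[[i j] /skew_col_gt0 + /= e].
  by rewrite -e.
rewrite count_map /skew count_filter /ferrers.
rewrite count_flatten -map_comp.
rewrite (eq_map (g := fun i => (col_height k a <= i < col_height k b) : nat));
  last first.
  move=> i /=; rewrite count_map.
  rewrite (eq_count (a2 := fun j => (j == k.+1) && (col_height k a <= i)));
    last first.
    move=> j /=; rewrite mem_ferrers; case: eqP => //= ->.
    by rewrite -ltnNge ltnS leqNgt nth_sort_partition -leqNgt.
  case: (leqP (col_height k a) i) => /= _.
    rewrite (eq_count (a2 := pred1 k.+1)); last by move=> j; rewrite andbT.
    by rewrite count_uniq_mem ?iota_uniq // mem_iota add1n /= ltnS
      nth_sort_partition.
  by rewrite (eq_count (a2 := pred0)) ?count_pred0 // => j; rewrite andbF.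
have le_b : col_height k b <= size (sort_partition b).
  rewrite leqNgt -nth_sort_partition nth_default //.
rewrite sumn_count count_range; lia.
Qed.

Lemma perm_skew_cols N a b :
  {in b, forall p, p <= N} ->
  perm_eq (strip_colmset (skew (sort_partition b) (sort_partition a)))
          (map S (col_diff (iota 0 N) a b)).
Proof.
move=> bN; apply/allP => s _ /=; apply/eqP; rewrite count_skew_cols count_map.
case: s => [|k]; first by rewrite (eq_count (a2 := pred0)) ?count_pred0.
rewrite (eq_count (a2 := pred1 k)); last by move=> j /=; rewrite eqSS.
rewrite count_col_diff ?iota_uniq // mem_iota /=; case: ltnP => // Nk.
have -> // : col_height k b = 0.
apply/eqP; rewrite -leqn0 leqNgt -has_count; apply/hasPn => p /bN pN.
by rewrite -leqNgt (leq_trans pN).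
Qed.

Lemma sort_skew_cols N a b : {in b, forall p, p <= N} ->
  sort leq (strip_colmset (skew (sort_partition b) (sort_partition a))) =
  map S (col_diff (iota 0 N) a b).
Proof.
move=> bN; apply: (sorted_eq leq_trans anti_leq).
- exact: sort_sorted leq_total _.
- by rewrite sorted_map; apply: sub_sorted (sorted_col_diff _ _ _ _).
- by rewrite perm_sort; apply: perm_skew_cols.
Qed.

Lemma size_skew N a b : {in b, forall p, p <= N} ->
  size (skew (sort_partition b) (sort_partition a)) =
    size (col_diff (iota 0 N) a b).
Proof.
move=> bN; rewrite -(size_map S) -(perm_size (perm_skew_cols a bN)).
by rewrite size_map.
Qed.

(** Removal from the largest column down never gets stuck: when column [k] is due, column [k + 1]
    already has its height in [a], so there are at least as many parts [k + 1] as cells to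
    remove. *)
Lemma hstrip_shrinks a b N : {in b, forall p, p <= N} ->
  (forall k, col_height k a <= col_height k b <= (col_height k a).+1) ->
  exists c, shrinks (col_diff (rev (iota 0 N)) a b) b = Some c.
Proof.
move=> bN hab.
(* In the state [d] the columns from [n] on are those of [a], the others still those of [b]. *)
suff gen n d : (forall j, j < n -> col_height j d = col_height j b) ->
    (forall j, n <= j -> col_height j d = col_height j a) ->
    exists c, shrinks (col_diff (rev (iota 0 n)) a b) d = Some c.
  apply: (gen) => // j Nj; have := hab j.
  have -> : col_height j b = 0.
    apply/eqP; rewrite -leqn0 leqNgt -has_count; apply/hasPn => p /bN pN.
    by rewrite -leqNgt (leq_trans pN).
  by rewrite leqn0 => /andP[/eqP ->].
elim: n d => [|n IH] d hlt hge; first by exists d.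
rewrite -addn1 iotaD rev_cat /=.
have [|c Ec hc] := @shrinks_nseq (col_height n b - col_height n a) n
  (col_diff (rev (iota 0 n)) a b) d.
  have := hab n; have := hge n.+1 (leqnn _); have := hlt n (leqnn _).
  have := col_heightS n d; have := col_height_mono n a; lia.
have -> : col_diff (n :: rev (iota 0 n)) a b =
  nseq (col_height n b - col_height n a) n ++
    col_diff (rev (iota 0 n)) a b by [].
rewrite Ec; apply: IH => j hj; have := hc j.
  by rewrite (_ : (j == n) = false) ?hlt; lia.
have [->|jn] := eqVneq j n; first by have := hlt n (leqnn _); have := hab n;
  lia.
by rewrite hge; lia.
Qed.

(** With the smallest column first, column [k + 1] still has its height in [b], at most that of
    column [k] in [a], so again enough parts [k + 1] are present. *)
Lemma vstrip_shrinks a b N : 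
  (forall k, col_height k a <= col_height k b) ->
  (forall k, col_height k.+1 b <= col_height k a) ->
  exists c, shrinks (col_diff (iota 0 N) a b) b = Some c.
Proof.
move=> hab hv.
suff gen n m d : (forall j, m <= j -> col_height j d = col_height j b) ->
    exists c, shrinks (col_diff (iota m n) a b) d = Some c by apply: (gen).
elim: n m d => [|n IH] m d hd; first by exists d.
have [|c Ec hc] := @shrinks_nseq (col_height m b - col_height m a) m
  (col_diff (iota m.+1 n) a b) d.
  have := hv m; have := hd m (leqnn _); have := hd m.+1 (leqnSn _).
  have := col_heightS m d; lia.
have -> : col_diff (iota m n.+1) a b =
  nseq (col_height m b - col_height m a) m ++ col_diff (iota m.+1 n) a b by [].
rewrite Ec; apply: IH => j hj; have := hc j.
by rewrite (_ : (j == m) = false) ?hd; lia.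
Qed.

(** For a strip all removals are possible, so [rem_part] does not meet its exceptional value.
    Conversely, the heights along the removals give inclusion, and the bound on them gives the strip
    condition. *)
Lemma hstrip_iff n N a b : is_composition b -> {in b, forall p, p <= N} ->
  (included (sort_partition a) (sort_partition b) /\
   let d := skew (sort_partition b) (sort_partition a) in
   horizontal_strip d /\ size d = n /\ row_op (strip_colset d) b = a) <->
  [/\ all (fun k => col_height k b <= (col_height k a).+1) (rev (iota 0 N)),
      shrinks (col_diff (rev (iota 0 N)) a b) b = Some a
    & size (col_diff (rev (iota 0 N)) a b) = n].
Proof.
move=> cb bN; have uN : uniq (rev (iota 0 N)) by rewrite rev_uniq iota_uniq.
have b0 k : N <= k -> col_height k b = 0.
  move=> Nk; apply/eqP; rewrite -leqn0 leqNgt -has_count;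
    apply/hasPn => p /bN pN.
  by rewrite -leqNgt (leq_trans pN).
have sz : size (col_diff (rev (iota 0 N)) a b) =
    size (skew (sort_partition b) (sort_partition a)).
  by rewrite -rev_col_diff size_rev (size_skew a bN).
have rowE : (forall k, col_height k b <= (col_height k a).+1) ->
    row_op (strip_colset (skew (sort_partition b) (sort_partition a))) b =
    collapse (foldl (fun b m => rem_part m b) b
      (map S (col_diff (rev (iota 0 N)) a b))).
  (* A horizontal strip repeats no column, so its list of columns is already duplicate free. *)
  move=> hh; rewrite /row_op /strip_colset undup_id.
    by rewrite (sort_skew_cols a bN) -rev_col_diff map_rev foldl_rev.
  rewrite (perm_uniq (perm_skew_cols a bN)) (map_inj_uniq succn_inj).
  apply/count_mem_uniq => k; apply/eqP; rewrite eqn_leq; apply/andP; split.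
    have [kc|kc] := boolP (k \in col_diff (iota 0 N) a b); last first.
      by rewrite (count_memPn kc).
    by rewrite count_col_diff ?iota_uniq //; have := hh k; case: ifP => _; lia.
  by have := has_pred1 k (col_diff (iota 0 N) a b); rewrite has_count => <-;
    case: posnP.
split=> [[inc [/horizontal_height hh [sn rw]]]|[al sh sn]].
  split; [by apply/allP | | by rewrite sz].
  have /included_height hi := inc.
  have [|c Ec] := @hstrip_shrinks a b N bN; first by move=> k; rewrite hi hh.
  by rewrite Ec -rw rowE //; congr Some; symmetry; apply: shrinks_rem_part;
    rewrite collapse_id.
have hi k : col_height k a <= col_height k b by rewrite (shrinks_height k sh)
  leq_addr.
have hh k : col_height k b <= (col_height k a).+1.
  have [kN|/b0 ->//] := ltnP k N.
  by apply: (allP al); rewrite mem_rev mem_iota.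
split; first exact/included_height.
split; first exact/horizontal_height.
split; first by rewrite -sz.
by rewrite rowE //; apply: shrinks_rem_part; rewrite collapse_id.
Qed.

(* Once a part has been decreased by the increasing sequence of columns, it is
   too small to be decreased again. *)
Lemma shrinks_vertical L b c : sorted leq L -> shrinks L b = Some c ->
  forall k, col_height k.+1 b <= col_height k c.
Proof.
move=> sL sh k.
suff : count_mem k L <= count_mem k.+1 b.
  by have := shrinks_height k sh; have := col_heightS k b; lia.
elim: L b sL sh => //= j L IH b jL; case E: (shrink j b) => [d|] //= sh.
have := col_heightS k b; rewrite (shrink_height k E) (shrink_height k.+1 E).
have := IH d (path_sorted jL) sh; have := col_heightS k d.
move: jL; rewrite path_sortedE; last exact: leq_trans.
move=> /andP[/allP jL _]; have [kj|kj|->] := ltngtP k j; last first.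
- rewrite (gtn_eqF (ltnSn j)) /=. lia.
- rewrite (gtn_eqF (leqW kj)) /=; lia.
- have -> : count_mem k L = 0 by apply/count_memPn/negP => /jL;
  rewrite leqNgt kj.
  by [].
Qed.

(** Here the strip condition follows from the removals alone, by [shrinks_vertical]. *)
Lemma vstrip_iff n N a b : is_composition b -> {in b, forall p, p <= N} ->
  (included (sort_partition a) (sort_partition b) /\
   let d := skew (sort_partition b) (sort_partition a) in
   vertical_strip d /\ size d = n /\ col_op (strip_colmset d) b = a) <->
  shrinks (col_diff (iota 0 N) a b) b = Some a /\
  size (col_diff (iota 0 N) a b) = n.
Proof.
move=> cb bN.
have colE : col_op (strip_colmset (skew (sort_partition b) (sort_partition a)))
  b =
    collapse (foldl (fun b m =>
      rem_part m b) b (map S (col_diff (iota 0 N) a b))).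
  by rewrite /col_op (sort_skew_cols a bN).
rewrite /= colE (size_skew a bN).
split=> [[/included_height hi [/vertical_height hv [sn rw]]]|[sh sn]].
  split=> //; have [c Ec] := vstrip_shrinks N hi hv.
  by rewrite Ec -rw; congr Some; symmetry; apply: shrinks_rem_part;
    rewrite collapse_id.
split; first by apply/included_height => k;
  rewrite (shrinks_height k sh) leq_addr.
split; first by apply/vertical_height; apply: shrinks_vertical sh;
  apply: sorted_col_diff.
by split=> //; apply: shrinks_rem_part; rewrite collapse_id.
Qed.

(** * Power series modulo a degree *)

(* [F n] is the coefficient of y^n in a power series in the x_i and y. *)
Definition yseries : Type := nat -> {cmonom nat} -> int.

HB.instance Definition _ := GRing.Zmodule.copy yseries (nat ->
  {cmonom nat} -> int).

(** Multiplication by x_(v + 1). The division [divcm] truncates exponents, hence the test. *)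
Definition mulX (v : nat) (F : yseries) : yseries := fun n m =>
  if 0 < m v then F n (divcm m (ucm v)) else 0%R.

Definition mulY (F : yseries) : yseries := fun n m =>
  if n is n'.+1 then F n' m else 0%R.

Definition opp_mulY (F : yseries) : yseries := (- mulY F)%R.

Lemma yserB (F G : yseries) n m : (F - G)%R n m = (F n m - G n m)%R.
Proof. by []. Qed.

Lemma mulX_zmod v : zmod_morphism (mulX v).
Proof.
move=> F G; apply/funext => n; apply/funext => m; rewrite yserB /mulX.
by case: ifP => // _; rewrite subr0.
Qed.

Lemma mulY_zmod : zmod_morphism mulY.
Proof.
move=> F G; apply/funext => -[|n]; apply/funext => m; rewrite yserB /mulY //.
Qed.

Lemma opp_mulY_zmod : zmod_morphism opp_mulY.
Proof. by move=> F G; rewrite /opp_mulY mulY_zmod opprB addrC opprK. Qed.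

HB.instance Definition _ v :=
  GRing.isZmodMorphism.Build yseries yseries (mulX v) (mulX_zmod v).
HB.instance Definition _ :=
  GRing.isZmodMorphism.Build yseries yseries mulY mulY_zmod.
HB.instance Definition _ :=
  GRing.isZmodMorphism.Build yseries yseries opp_mulY opp_mulY_zmod.

Lemma mulXY v F : mulX v (mulY F) = mulY (mulX v F).
Proof.
by apply/funext => -[|n]; apply/funext => m; rewrite /mulX /mulY //; case: ifP.
Qed.

Lemma mulXX u v F : mulX v (mulX u F) = mulX u (mulX v F).
Proof.
apply/funext => n; apply/funext => m; rewrite /mulX !divcmE !ucmE.
have [->//|uv] := eqVneq u v.
rewrite /= !subn0; case: ifP; case: ifP => // _ _.
by congr (F n _); apply/eqP/cmP => i; rewrite !divcmE subnAC.
Qed.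

Lemma mdeg_divU (m : {cmonom nat}) v : 0 < m v ->
  (mdeg (divcm m (ucm v))).+1 = mdeg m.
Proof.
move=> mv; rewrite -[in RHS](_ : mmul (ucm v) (divcm m (ucm v)) = m).
  by rewrite mdegM mdegU.
by apply/eqP/cmP => i; rewrite cmM divcmE ucmE; case: eqP mv => [->|_] /=; lia.
Qed.

Lemma sumn_grow k b c : grow k b = Some c -> sumn c = (sumn b).+1.
Proof.
case: k => [[<-] //|k]; rewrite /grow; elim: b c => //= x b IH c.
case: eqP => [-> [<-] //|_];
  case: (inc_first _ b) IH => //= d /(_ d erefl) e [<-].
by rewrite /= e addnS.
Qed.

Lemma sumn_shrink k b c : shrink k b = Some c -> sumn b = (sumn c).+1.
Proof.
elim: b c => //= x b IH c; case: (shrink k b) IH => [d /(_ d erefl) e [<-]|_].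
  by rewrite /= e addnS.
by case: eqP => // -> [<-]; case: k.
Qed.

Section ModuloDegree.
Variable N : nat.
Implicit Types f g : seq nat -> yseries.

(* Growing increases [sumn b] as much as it decreases the degree that is left,
   so that all operators below respect this equivalence. *)
Definition eqmod f g : Prop :=
  forall b n m, sumn b + mdeg m < N -> f b n m = g b n m.

Definition yeqmod (F G : yseries) : Prop :=
  forall n m, mdeg m < N -> F n m = G n m.

Lemma eqmod_grow v k f g : eqmod f g ->
  eqmod (step (grow k) (mulX v) f) (step (grow k) (mulX v) g).
Proof.
move=> fg b n m lt_N; rewrite /step.
change ((f b n m + mulX v (oapp f 0 (grow k b)) n m)%R =
        (g b n m + mulX v (oapp g 0 (grow k b)) n m)%R).
rewrite (fg b) //; congr (_ + _)%R; rewrite /mulX; case: ifP => // mv.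
case E: (grow k b) => [c|] //=; apply: fg.
by rewrite (sumn_grow E) addSnnS mdeg_divU.
Qed.

Lemma eqmod_grow_strip v K f g : eqmod f g ->
  eqmod (grow_strip (mulX v) K f) (grow_strip (mulX v) K g).
Proof. by elim: K f g => //= K IH f g fg; apply/IH/eqmod_grow. Qed.

Lemma eqmod_geom k f g : eqmod f g ->
  eqmod (shrink_geom mulY k f) (shrink_geom mulY k g).
Proof.
move=> fg b; have [j] := ubnP (count_mem k.+1 b).
elim: j b => // j IH b lt_j n m lt_N; rewrite !shrink_geomE.
change ((f b n m + mulY (oapp (shrink_geom mulY k f) 0 (shrink k b)) n m)%R =
        (g b n m + mulY (oapp (shrink_geom mulY k g) 0 (shrink k b)) n m)%R).
rewrite (fg b) //; congr (_ + _)%R; case: n => //= n.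
case E: (shrink k b) => [c|] //=; apply: IH.
  by move: lt_j; rewrite (count_shrink E).
by move: lt_N; rewrite (sumn_shrink E); lia.
Qed.

Lemma eqmod_vstrip K f g : eqmod f g ->
  eqmod (shrink_vstrip mulY K f) (shrink_vstrip mulY K g).
Proof. by elim: K f g => //= K IH f g fg; apply/IH/eqmod_geom. Qed.

End ModuloDegree.

(** * Scalar factors *)

Section Scalars.
Local Open Scope ring_scope.
Variable M : zmodType.
Implicit Types (f : seq nat -> M) (x y z : {additive M -> M}).

Lemma step_scal act x z f : (forall u, z (x u) = x (z u)) ->
  step act x (fun b => z (f b)) = fun b => z (step act x f b).
Proof.
move=> zx; apply/funext => b; rewrite /step raddfD /= zx; congr (_ + x _).
by case: (act b) => //=; rewrite raddf0.
Qed.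

Lemma grow_strip_scal x z N f : (forall u, z (x u) = x (z u)) ->
  grow_strip x N (fun b => z (f b)) = fun b => z (grow_strip x N f b).
Proof. by move=> zx; elim: N f => //= N IH f; rewrite step_scal // IH. Qed.

Lemma shrink_geom_scal y z k f : (forall u, z (y u) = y (z u)) ->
  shrink_geom y k (fun b => z (f b)) = fun b => z (shrink_geom y k f b).
Proof.
move=> zy; apply/funext => b; have [j] := ubnP (count_mem k.+1 b).
elim: j b => // j IH b lt_j; rewrite !shrink_geomE raddfD /= zy;
  congr (_ + y _).
case E: (shrink k b) => [c|] /=; last by rewrite raddf0.
by apply: IH; move: lt_j; rewrite (count_shrink E).
Qed.

Lemma shrink_vstrip_scal y z N f : (forall u, z (y u) = y (z u)) ->
  shrink_vstrip y N (fun b => z (f b)) = fun b => z (shrink_vstrip y N f b).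
Proof. by move=> zy; elim: N f => //= N IH f;
  rewrite shrink_geom_scal // IH. Qed.

Lemma shrink_strip_nil y N f : shrink_strip y N f [::] = f [::].
Proof. by elim: N => //= N IH; rewrite /step /= raddf0 addr0. Qed.

Lemma shrink_vstrip_nil y N f : shrink_vstrip y N f [::] = f [::].
Proof. by elim: N f => //= N IH f; rewrite IH. Qed.

End Scalars.

(** Multiplication by 1 - x_(v + 1) y; with [opp_mulY] in place of [y] it becomes 1 + x_(v + 1)
    y. *)
Definition qfac v (y : {additive yseries -> yseries}) (u : yseries) : yseries :=
  (u - mulX v (y u))%R.

Lemma qfac_zmod v y : zmod_morphism (qfac v y).
Proof.
move=> F G; rewrite /qfac (raddfB y) (raddfB (mulX v)) /= !opprB.
by rewrite [X in (_ + X)%R = _]addrC addrACA [X in (_ + X)%R = _]addrC.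
Qed.

HB.instance Definition _ v y :=
  GRing.isZmodMorphism.Build yseries yseries (qfac v y) (qfac_zmod v y).

Fixpoint qprod (y : {additive yseries -> yseries}) V (u : yseries) : yseries :=
  if V is V'.+1 then qfac V' y (qprod y V' u) else u.

Lemma qprod_zmod y V : zmod_morphism (qprod y V).
Proof. by elim: V => //= V IH F G; rewrite IH raddfB. Qed.

HB.instance Definition _ y V :=
  GRing.isZmodMorphism.Build yseries yseries (qprod y V) (qprod_zmod y V).

Lemma qfac_comm v (y z : {additive yseries -> yseries}) u :
  (forall F, z (mulX v F) = mulX v (z F)) -> (forall F, z (y F) = y (z F)) ->
  z (qfac v y u) = qfac v y (z u).
Proof. by move=> zx zy; rewrite /qfac raddfB /= zx zy. Qed.

Lemma qprod_comm V (y z : {additive yseries -> yseries}) u :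
  (forall v F, z (mulX v F) = mulX v (z F)) -> (forall F, z (y F) = y (z F)) ->
  z (qprod y V u) = qprod y V (z u).
Proof. by move=> zx zy; elim: V => //= V IH; rewrite qfac_comm // IH. Qed.

(** * The product of the operators T(x_i) and its exchange with strips *)

Section WordOperator.
Variable N : nat.
Implicit Types (f g : seq nat -> yseries) (y : {additive yseries -> yseries}).

(** The transpose of T(x_1) ... T(x_V), cut off at the columns below [N]; the largest variable acts
    on the composition first. *)
Fixpoint word_op (V : nat) f : seq nat -> yseries :=
  if V is V'.+1 then grow_strip (mulX V') N (word_op V' f) else f.

Definition low_degree y : Prop :=
  forall (F G : yseries), (forall K, yeqmod K F G -> yeqmod K (y F) (y G)).

Lemma eqmod_qfac v y f g : low_degree y -> eqmod N f g ->
  eqmod N (fun b => qfac v y (f b)) (fun b => qfac v y (g b)).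
Proof.
move=> hy fg b n m lt_N; rewrite /qfac !yserB; congr (_ - _)%R; first exact: fg.
rewrite /mulX; case: ifP => // mv; apply: (hy _ _ (N - sumn b)).
  by move=> n' m' lt_m; apply: fg; lia.
rewrite ltn_subRL (leq_ltn_trans _ lt_N) // leq_add2l.
by rewrite -(mdeg_divU mv).
Qed.

(** A composition of a number below [N] has no part [N], so Z_N acts on it as 1 - x y. *)
Lemma eqmod_defect v y f :
  eqmod N (fun b => qfac v y (f b)) (defect (mulX v) y N f).
Proof.
move=> b n m lt_N; rewrite /defect /has_part.
have -> : (N == 0) = false by lia.
case: ifP => //= Nb; suff : N <= sumn b by lia.
by elim: b Nb {lt_N} => //= x b IH; rewrite inE => /orP[/eqP ->|/IH]; lia.
Qed.

Lemma eqmod_trans f g h : eqmod N f g -> eqmod N g h -> eqmod N f h.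
Proof. by move=> fg gh b n m lt_N; rewrite fg // gh. Qed.

Lemma mulY_low : low_degree mulY.
Proof. by move=> F G K h [|n] m lt_K //=; apply: h. Qed.

Lemma opp_mulY_low : low_degree opp_mulY.
Proof.
by move=> F G K h n m lt_K; congr (- _)%R; apply: (mulY_low h).
Qed.

Lemma opp_mulYX v F : mulX v (opp_mulY F) = opp_mulY (mulX v F).
Proof. by rewrite /opp_mulY raddfN /= mulXY. Qed.

(** One exchange for each variable, the truncated Z_N being replaced by its factor 1 - x_i y; these
    factors commute with everything and collect in front. *)
Lemma word_op_hstrip V g :
  eqmod N (fun b => qprod mulY V (word_op V (shrink_strip mulY N g) b))
          (shrink_strip mulY N (word_op V g)).
Proof.
elim: V => [|V IH] //=.
pose h := fun b => qprod mulY V (word_op V (shrink_strip mulY N g) b).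
have -> : (fun b => qfac V mulY (qprod mulY V
      (grow_strip (mulX V) N (word_op V (shrink_strip mulY N g)) b))) =
    grow_strip (mulX V) N (fun b => qfac V mulY (h b)).
  rewrite (grow_strip_scal (z := qfac V mulY)); last first.
    by move=> u; rewrite [RHS](qfac_comm (z := mulX V)) //; apply: mulXY.
  rewrite (grow_strip_scal (z := qprod mulY V)) // => u.
  by rewrite (qprod_comm V (z := mulX V)) //= => *;
    [apply: mulXX | apply: mulXY].
rewrite -(strip_exchange _ _ (mulXY V)); apply: eqmod_grow_strip.
exact: eqmod_trans (eqmod_qfac V mulY_low IH) (eqmod_defect _ _ _).
Qed.

Lemma word_op_vstrip V g :
  eqmod N (word_op V (shrink_vstrip mulY N g))
    (fun b => qprod opp_mulY V (shrink_vstrip mulY N (word_op V g) b)).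
Proof.
elim: V => [|V IH] //=.
pose C := shrink_vstrip mulY N; pose T := grow_strip (mulX V) N.
have e1 : eqmod N (T (word_op V (C g)))
    (T (fun b => qprod opp_mulY V (C (word_op V g) b))).
  exact: eqmod_grow_strip.
apply: eqmod_trans e1 _; rewrite /T (grow_strip_scal (z := qprod opp_mulY V));
  last first.
  by move=> u; rewrite (qprod_comm V (z := mulX V)) //= => *;
    [apply: mulXX | apply: opp_mulYX].
rewrite -(vstrip_exchange (y' := opp_mulY) _ _ _ (mulXY V)) //.
(* The new factor moves inside the strips, to the place where [vstrip_exchange] puts its defect. *)
have -> : (fun b => qfac V opp_mulY (qprod opp_mulY V (shrink_vstrip mulY N
     (grow_strip (mulX V) N (word_op V g)) b))) =
   fun b => qprod opp_mulY V (shrink_vstrip mulY N (grow_strip (mulX V) N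
     (fun b => qfac V opp_mulY (word_op V g b))) b).
  rewrite (grow_strip_scal (z := qfac V opp_mulY)); last first.
    by move=> u; rewrite [RHS](qfac_comm (z := mulX V)) //; apply: opp_mulYX.
  rewrite (shrink_vstrip_scal (z := qfac V opp_mulY)); last first.
    by move=> u; rewrite [RHS](qfac_comm (z := mulY)) //= => F;
      rewrite ?mulXY // /opp_mulY raddfN.
  apply/funext => b; rewrite (qprod_comm V (z := qfac V opp_mulY)) // =>
    [v F|F].
    by rewrite [RHS](qfac_comm (z := mulX v)) //= => G;
      [apply: mulXX | apply: opp_mulYX].
  by rewrite [RHS](qfac_comm (z := opp_mulY)) //= => G; rewrite opp_mulYX.
have lowQ f g' : eqmod N f g' ->
    eqmod N (fun b => qprod opp_mulY V (f b)) (fun b =>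
      qprod opp_mulY V (g' b)).
  by move=> fg; elim: V {IH T} => //= V IH; apply: eqmod_qfac opp_mulY_low _.
apply: lowQ; apply: eqmod_vstrip; apply: eqmod_grow_strip => b n m lt_N.
by rewrite eqmod_defect.
Qed.

(** The constant term of 1 - x y is 1, so the coefficients of the powers of y are recovered one
    after the other. *)
Lemma qfac_inj v F G : yeqmod N (qfac v mulY F) (qfac v mulY G) -> yeqmod N F G.
Proof.
move=> h n; elim: n => [|n IH] m lt_m; have := h _ m lt_m.
  by move/(_ 0); rewrite /qfac !yserB /mulX /mulY; case: ifP => _;
    rewrite !subr0.
move/(_ n.+1); rewrite /qfac !yserB /mulX; case: ifP => mv;
  last by rewrite !subr0.
by rewrite /= IH; [move/addIr | rewrite (leq_ltn_trans _ lt_m) // -(mdeg_divU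
  mv)].
Qed.

Lemma qprod_inj V F G : yeqmod N (qprod mulY V F) (qprod mulY V G) ->
  yeqmod N F G.
Proof. by elim: V => //= V IH /qfac_inj/IH. Qed.

End WordOperator.

(** * Quasisymmetric Schur functions as sums over words *)

Fixpoint subwords (L : seq (nat * nat)) : seq (seq (nat * nat)) :=
  if L is c :: L' then subwords L' ++ map (cons c) (subwords L') else [:: [::]].

(** All letters with entries up to [V] and columns below [N], listed in the order [cell_lt], so that
    subsequences are admissible words. *)
Fixpoint letters (N V : nat) : seq (nat * nat) :=
  if V is V'.+1 then [seq (V'.+1, k) | k <- iota 0 N] ++ letters N V' else [::].

Definition mulXs (w : seq (nat * nat)) (u : yseries) : yseries :=
  foldr (fun c => mulX c.1.-1) u w.

Lemma mulXs0 w : mulXs w 0%R = 0%R.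
Proof. by elim: w => //= c w ->; rewrite raddf0. Qed.

Lemma foldr_step_sum L f b :
  foldr (fun c => step (grow c.2) (mulX c.1.-1)) f L b =
  (\sum_(w <- subwords L) mulXs w (oapp f 0 (grows w b)))%R.
Proof.
elim: L b => [|c L IH] b /=; first by rewrite big_seq1.
rewrite /step IH big_cat big_map /=; congr (_ + _)%R.
case: (grow c.2 b) => [d|] /=; first by rewrite IH raddf_sum.
by rewrite raddf0 big1 // => w _; rewrite mulXs0 raddf0.
Qed.

Lemma word_op_sum N V f b :
  word_op N V f b =
  (\sum_(w <- subwords (letters N V)) mulXs w (oapp f 0 (grows w b)))%R.
Proof.
rewrite -foldr_step_sum; congr (_ b).
have grow_stripE x K g :
    grow_strip x K g = foldr (fun k =>
      step (grow k) x) g (iota 0 K) :> (_ -> yseries).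
  elim: K g => // K IHK g.
  by rewrite [LHS]/= IHK -[in RHS](addn1 K) iotaD foldr_cat.
elim: V => //= V ->; by rewrite grow_stripE foldr_cat foldr_map.
Qed.

Definition mdvd (a m : {cmonom nat}) : bool := mmul a (divcm m a) == m.

Lemma mdvdP (a m : {cmonom nat}) : reflect (forall i, a i <= m i) (mdvd a m).
Proof.
apply: (iffP (cmP _ _)) => h i; have := h i; rewrite cmM divcmE; lia.
Qed.

Lemma content_cons c w : content (c :: w) = mmul (ucm c.1.-1) (content w).
Proof. by rewrite /content big_cons. Qed.

Lemma mulXsE w u n m :
  mulXs w u n m = if mdvd (content w) m then u n (divcm m (content w)) else 0%R.
Proof.
elim: w m => [|c w IH] m /=.
  have -> : content [::] = mone by rewrite /content big_nil.
  have -> : mdvd mone m by apply/mdvdP => i; rewrite cm1.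
  by congr (u n _); apply/eqP/cmP => i; rewrite divcmE cm1 subn0.
rewrite /mulX content_cons; move: c.1.-1 => v; have [mv|mv] := ltnP 0 (m v).
  rewrite IH; have -> : mdvd (content w) (divcm m (ucm v)) =
      mdvd (mmul (ucm v) (content w)) m.
    apply/mdvdP/mdvdP => h i; have := h i; rewrite cmM divcmE ucmE;
      by case: eqP mv => [->|_] mv; lia.
  case: ifP => // _; congr (u n _); apply/eqP/cmP => i.
  by rewrite !divcmE cmM subnDA.
case: mdvdP => // /(_ v); rewrite cmM ucmE eqxx; lia.
Qed.

Definition yone : yseries := fun n m => ((n == 0) && (m == mone))%:R%R.

Lemma mdvd_refl m : mdvd m m.
Proof. exact/mdvdP. Qed.

Lemma mulXs_one w n m : mulXs w yone n m = ((n == 0) && (content w == m))%:R%R.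
Proof.
rewrite mulXsE /yone; case: ifP => [/eqP dv|dv]; last first.
  by case: (content w =P m) => [e|_];
    [rewrite e mdvd_refl in dv | rewrite andbF].
congr (_ && _)%:R%R; apply/eqP/eqP => [d1|->].
  by rewrite -dv d1 /mmul /= mulcm0.
by apply/eqP/cmP => i; rewrite divcmE cm1 subnn.
Qed.

Lemma fsum_list (I : choiceType) (P : set I) (f : I -> int) (s : seq I) :
  uniq s -> (forall i, i \in s -> P i) ->
  (forall i, P i -> f i <> 0%R -> i \in s) ->
  (\sum_(i \in P) f i = \sum_(i <- s) f i)%R.
Proof.
move=> us sP Ps; rewrite [RHS]fsbig_seq //; apply/esym/fsbig_widen => //.
move=> i [Pi ni]; apply: contrapT => fi; apply: ni; exact: Ps fi.
Qed.

Lemma mem_subwords_filter p L : filter p L \in subwords L.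
Proof.
elim: L => //= c L IH; rewrite mem_cat.
by case: ifP => _; rewrite ?IH // map_f ?orbT.
Qed.

Lemma subwords_subseq L w : w \in subwords L -> subseq w L.
Proof.
elim: L w => [|c L IH] w /=; first by rewrite inE => /eqP ->.
rewrite mem_cat => /orP[/IH h|/mapP[w' /IH h ->]]; last by rewrite /= eqxx.
exact: subseq_trans h (subseq_cons _ _).
Qed.

Lemma uniq_subwords L : uniq L -> uniq (subwords L).
Proof.
elim: L => //= c L IH /andP[cL /IH uL]; rewrite cat_uniq uL /=.
rewrite map_inj_uniq ?uL ?andbT; last by move=> ? ? [].
apply/hasPn => _ /mapP[w _ ->]; apply/negP => /subwords_subseq/mem_subseq/(_ c).
by rewrite inE eqxx (negbTE cL) => /(_ isT).
Qed.

Lemma mem_letters N V c : (c \in letters N V) = (0 < c.1 <= V) && (c.2 < N).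
Proof.
case: c => v k /=; elim: V => [|V IH]; first by rewrite inE; lia.
rewrite mem_cat IH; apply/orP/idP => [[/mapP[j] | ]|].
- by rewrite mem_iota => /= jN [-> ->]; lia.
- by lia.
have [-> h|ne h] := eqVneq v V.+1; last by right; lia.
by left; apply: map_f; rewrite mem_iota; lia.
Qed.

Lemma sorted_letters N V : sorted cell_lt (letters N V).
Proof.
rewrite (sorted_pairwise cell_lt_trans); elim: V => //= V IH.
rewrite pairwise_cat IH andbT; apply/andP; split.
  apply/allrelP => _ d /mapP[k _ ->]; rewrite mem_letters /cell_lt /=; lia.
rewrite pairwise_map (@sub_pairwise _ ltn) //.
  by move=> i j /= ij; rewrite /cell_lt /= eqxx ij orbT.
by rewrite -(sorted_pairwise ltn_trans) iota_ltn_sorted.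
Qed.

Lemma uniq_letters N V : uniq (letters N V).
Proof. exact: sorted_uniq cell_lt_trans cell_lt_irr _ (sorted_letters N V). Qed.

Lemma subwords_ok N V w : w \in subwords (letters N V) -> word_ok w.
Proof.
move=> /subwords_subseq sw; apply/andP; split.
  exact: subseq_sorted cell_lt_trans _ _ sw (sorted_letters N V).
by apply/allP => c /(mem_subseq sw); rewrite mem_letters => /andP[/andP[]].
Qed.

Lemma sumn_grows w b a : grows w b = Some a -> sumn a = sumn b + size w.
Proof.
elim: w b => [|c w IH] b /=; first by move=> [->]; rewrite addn0.
by case E: (grow c.2 b) => [d|] //= /IH ->; rewrite (sumn_grow E) addSnnS.
Qed.

Lemma mem_leq_sumn k b : k \in b -> k <= sumn b.
Proof. by elim: b => //= x b IH; rewrite inE => /orP[/eqP ->|/IH]; lia. Qed.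

(** For [k] positive, t_k needs a part [k], which is at most the sum reached so far. *)
Lemma grows_bound w b a c : grows w b = Some a -> c \in w ->
  c.2 < sumn b + size w.
Proof.
elim: w b => //= d w IH b; case E: (grow d.2 b) => [e|] //= h.
rewrite inE => /orP[/eqP ->|/(IH _ h)]; last by rewrite (sumn_grow E) addSnnS.
case: d E => v [|k] //= E; first by rewrite addnS.
have : k.+1 \in b by apply: contraT => /inc_first_None; rewrite E.
by move=> /mem_leq_sumn; lia.
Qed.

Lemma mdeg_content w : mdeg (content w) = size w.
Proof.
rewrite /content mdeg_prod (eq_bigr (fun=> 1)); last by move=> c _;
  rewrite mdegU.
by rewrite sum1_size.
Qed.

Lemma content_pos w c : c \in w -> 0 < (content w) c.1.-1.
Proof.
elim: w => // d w IH; rewrite inE content_cons cmM ucmE => /orP[/eqP ->|/IH];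
  last by lia.
by rewrite eqxx.
Qed.

Definition bounded (N V : nat) (m : {cmonom nat}) : Prop :=
  mdeg m < N /\ forall v, 0 < m v -> v < V.

Lemma word_in_subwords N V w a : word_ok w -> grows w [::] = Some a ->
  bounded N V (content w) -> w \in subwords (letters N V).
Proof.
move=> /andP[sw pw] gw [dN dV].
have -> : w = filter (mem w) (letters N V); last exact: mem_subwords_filter.
apply: (irr_sorted_eq cell_lt_trans cell_lt_irr sw).
  exact: sorted_filter cell_lt_trans _ _ (sorted_letters N V).
move=> c; rewrite mem_filter /=; case cw: (c \in w) => //=; symmetry.
rewrite mem_letters; have := dV _ (content_pos cw); have := allP pw c cw.
have := grows_bound gw cw; move: dN; rewrite mdeg_content /=; lia.
Qed.

(** The words of content [m] leading to [a] correspond to the SSAFs of weight [m] counted by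
    [qschur a]; the bounds on [m] put all of them among the subwords of a finite list. *)
Theorem qschurE N V a m : bounded N V m ->
  qschur a m = (\sum_(w <- subwords (letters N V))
    ((grows w [::] == Some a) && (content w == m))%:R)%R.
Proof.
move=> bm.
pose W := [seq w <- subwords (letters N V) | (grows w [::] == Some a) &&
  (content w == m)].
have WP w : w \in W -> [/\ word_ok w, grows w [::] = Some a & content w = m].
  by rewrite mem_filter => /andP[/andP[/eqP ? /eqP ?] /subwords_ok].
pose FF := map ssaf_of W.
have uFF : uniq FF.
  rewrite map_inj_in_uniq ?filter_uniq ?uniq_subwords ?uniq_letters //.
  by move=> w w' /WP[ok gw _] /WP[ok' gw' _]; apply: ssaf_of_inj gw gw'.
have FFP F : F \in FF -> [/\ is_ssaf (shape F) F, 0 < last 1 (shape F),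
    collapse (shape F) = a & weight F = m].
  by move=> /mapP[w /WP[ok gw <-] ->]; apply: ssaf_of_word.
have inFF g F : is_ssaf g F -> 0 < last 1 g -> collapse g = a -> weight F = m ->
    F \in FF.
  move=> HF lg cg wF; have [w [ok gw eF]] := ssaf_word HF lg.
  rewrite cg in gw; have [_ _ _ cw] := ssaf_of_word ok gw.
  rewrite -eF map_f // mem_filter gw eqxx -cw eF wF eqxx /=.
  by apply: (word_in_subwords ok gw); rewrite -cw eF wF.
have atomE g : 0 < last 1 g -> collapse g = a ->
    demazure_atom g m = (\sum_(F <- FF) (shape F == g)%:R)%R.
  move=> lg cg; rewrite /demazure_atom /fps_sum.
  rewrite (@fsum_list _ _ _ [seq F <- FF | shape F == g]) ?filter_uniq //.
  - rewrite big_filter big_mkcond; apply: eq_big_seq => F /FFP[_ _ _ wF].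
    by rewrite /fps_monomial wF eqxx; case: ifP.
  - by move=> F; rewrite mem_filter => /andP[/eqP <- /FFP[]].
  move=> F HF; rewrite /fps_monomial; case: eqP => // mF _.
  by rewrite mem_filter (inFF g) // andbT; case: HF => ->.
rewrite /qschur /fps_sum (@fsum_list _ _ _ (undup (map shape FF))) ?undup_uniq
  //.
- transitivity (\sum_(g <- undup (map shape FF)) \sum_(F <- FF) (shape F ==
  g)%:R : int)%R.
    apply: eq_big_seq => g; rewrite mem_undup => /mapP[F /FFP[_ lF cF _] ->].
    exact: atomE.
  (* Each filling has exactly one shape, so it is counted once. *)
  rewrite exchange_big /= (eq_big_seq (fun=> 1%R)); last first.
    move=> F FFF; rewrite -natr_sum -big_mkcond /= sum1_count.
    rewrite (eq_count (a2 := pred1 (shape F))); last by move=> g;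
      rewrite /= eq_sym.
    by rewrite count_uniq_mem ?undup_uniq // mem_undup map_f.
  by rewrite big_map big_filter big_mkcond; apply: eq_bigr => w _; case: ifP.
- by move=> g; rewrite mem_undup => /mapP[F /FFP[_ lF cF _] ->].
move=> g [lg cg]; rewrite atomE // mem_undup => ne; apply/negPn/negP => ng.
apply: ne; rewrite big_seq big1 // => F FFF; case: eqP => // e.
by move: ng; rewrite -e map_f.
Qed.

(** * The Pieri rules *)

Local Open Scope classical_set_scope.
Local Open Scope nat_scope.

Lemma big_eq_uniq (I : eqType) (r : seq I) (i : I) (F : I -> int) :
  uniq r -> (\sum_(j <- r) (i == j)%:R * F j)%R = if i \in r then F i else 0%R.
Proof.
move=> ur; case: ifP => ir.
  rewrite (bigD1_seq i) //= eqxx mul1r big1 ?addr0 // => j /negbTE ji.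
  by rewrite eq_sym ji mul0r.
rewrite big_seq big1 // => j jr; case: eqP => [e|_]; last by rewrite mul0r.
by rewrite e jr in ir.
Qed.

(** The first factor is a sum of monomials listed with repetitions in [W], as [qschurE] provides;
    only the divisors of [m] matter. *)
Lemma fps_mul_list (f g : fps) m (W : seq {cmonom nat}) :
  (forall d, mdvd d m -> f d = \sum_(u <- W) (u == d)%:R)%R ->
  fps_mul f g m = (\sum_(u <- W) if mdvd u m then g (divcm m u) else 0)%R.
Proof.
move=> fW; rewrite /fps_mul.
pose s := [seq (u, divcm m u) | u <- undup W & mdvd u m].
rewrite (@fsum_list _ _ _ s).
- rewrite /s big_map big_filter big_mkcond /=.
  transitivity (\sum_(u <- undup W) \sum_(u' <- W)
      (u' == u)%:R * (if mdvd u m then g (divcm m u) else 0))%R.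
    apply: eq_bigr => u _; rewrite -mulr_suml; case: ifP => [/fW -> //|_].
    by rewrite mulr0.
  rewrite exchange_big /=; apply: eq_big_seq => u uW.
  by rewrite big_eq_uniq ?undup_uniq // mem_undup uW.
- by rewrite map_inj_uniq ?filter_uniq ?undup_uniq // => u u' [].
- by move=> _ /mapP[u + ->]; rewrite mem_filter => /andP[/eqP].
move=> [d e] /= dem ne.
have dm : mdvd d m by apply/mdvdP => i; rewrite -dem cmM leq_addr.
have -> : e = divcm m d by apply/eqP/cmP => i; rewrite -dem divcmE cmM addKn.
apply: (map_f (fun u => (u, divcm m u))); rewrite mem_filter dm mem_undup /=.
apply: contraT => dW; case: ne; rewrite fW // big_seq big1 ?mul0r // => u uW.
by case: eqP => // e'; rewrite -e' uW in dW.
Qed.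

Lemma bounded_dvd N V d m : bounded N V m -> mdvd d m -> bounded N V d.
Proof.
move=> [mN mV] /[dup] /mdvdP dm /eqP e; split=> [|v dv].
  by apply: leq_ltn_trans mN; rewrite -e mdegM leq_addr.
by apply: mV; apply: leq_trans dv (dm v).
Qed.

Lemma bounded_div N V d m : bounded N V m -> mdvd d m ->
  bounded N V (divcm m d).
Proof.
move=> bm /[dup] /mdvdP dm /eqP e; apply: bounded_dvd bm _.
by apply/mdvdP => i; rewrite divcmE leq_subr.
Qed.

Lemma yser_sum (I : Type) (r : seq I) (P : pred I) (F : I -> yseries) n m :
  (\sum_(i <- r | P i) F i)%R n m = (\sum_(i <- r | P i) F i n m)%R.
Proof. by elim/big_rec2: _ => // i x F' _ <-. Qed.

Lemma iter_mulY s (u : yseries) n m :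
  iter s mulY u n m = if s <= n then u (n - s) m else 0%R.
Proof.
elim: s n => [|s IH] n /=; first by rewrite subn0.
by case: n => //= n; rewrite IH.
Qed.

Lemma grow_composition k b c : grow k b = Some c -> is_composition b ->
  is_composition c.
Proof.
case: k => [[<-] //|k]; rewrite /grow; elim: b c => //= x b IH c.
case: eqP => [_ [<-] /andP[]//|_]; case: (inc_first _ b) IH => //= d IH [<-].
by move=> /andP[x0 /(IH d erefl)] /=; rewrite x0.
Qed.

Lemma shrink_composition k b c :
  shrink k b = Some c -> is_composition b -> is_composition c.
Proof.
elim: b c => //= x b IH c; case: (shrink k b) IH => [d /(_ d erefl) IH [<-]|_].
  by move=> /andP[x0 /IH] /=; rewrite x0.
by case: eqP => // _ [<-] /andP[_]; case: k.
Qed.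

Lemma grows_composition w b a : grows w b = Some a -> is_composition b ->
  is_composition a.
Proof.
elim: w b => [b [->]|c w IH b] //=; case E: (grow c.2 b) => [d|] //= /IH h.
by move=> /(grow_composition E).
Qed.

Lemma shrinks_composition L b c :
  shrinks L b = Some c -> is_composition b -> is_composition c.
Proof.
elim: L b => [b [->]|k L IH b] //=; case E: (shrink k b) => [d|] //= /IH h.
by move=> /(shrink_composition E).
Qed.

Lemma sumn_shrinks L b c : shrinks L b = Some c -> sumn b = sumn c + size L.
Proof.
elim: L b => [b [->]|k L IH b] /=; first by rewrite addn0.
by case E: (shrink k b) => [d|] //= /IH; rewrite (sumn_shrink E) addnS => ->.
Qed.

Lemma word_op_delta N V a n m :
  word_op N V (delta a yone) [::] n m =
  (\sum_(w <- subwords (letters N V))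
     [&& n == 0, grows w [::] == Some a & content w == m]%:R)%R.
Proof.
rewrite word_op_sum yser_sum; apply: eq_bigr => w _.
case: (grows w [::]) => [b|] /=; last by rewrite mulXs0 andbF.
rewrite /delta; have [->|ne] := eqVneq b a; first by rewrite mulXs_one eqxx.
rewrite mulXs0 (_ : (Some b == Some a) = false) ?andbF //.
by apply/eqP => -[]; apply/eqP.
Qed.

Lemma word_op_qschur N V a n m : bounded N V m ->
  word_op N V (delta a yone) [::] n m = if n == 0 then qschur a m else 0%R.
Proof.
move=> bm; rewrite word_op_delta (qschurE a bm); case: (n =P 0) => _.
  by apply: eq_bigr => w _; rewrite andTb.
by rewrite big1.
Qed.

(** Each letter adds a cell, so only the empty word ends at the empty composition. *)
Lemma word_op_delta_nil N V (u : yseries) : word_op N V (delta [::] u) [::] = u.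
Proof.
rewrite word_op_sum (bigD1_seq [::]) ?uniq_subwords ?uniq_letters //=;
  last first.
  by elim: (letters N V) => //= c L IH; rewrite mem_cat IH.
rewrite /delta eqxx big1 ?addr0 // => w w0.
case E: (grows w [::]) => [b|] /=; last exact: mulXs0.
case: eqP => [b0|_]; last exact: mulXs0.
by have := sumn_grows E; rewrite b0 /= add0n => /esym/size0nil w0';
  rewrite w0' in w0.
Qed.

(** The coefficient of y^n in the assumed congruence. Starting from the empty composition the strips
    of size [n] single out [kap], which yields the product; starting from [a] they yield the sum
    over [U]. *)
Lemma pieri_of_operator (K : (seq nat -> yseries) -> seq nat -> yseries)
    (ok : seq nat -> seq nat -> bool) (sz : seq nat -> seq nat -> nat)
    (kap a : seq nat) (n N V : nat) (m : {cmonom nat}) (U : seq nat -> Prop) :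
  bounded N V m ->
  (forall a u b, K (delta a u) b =
    if ok a b then iter (sz a b) mulY u else 0%R) ->
  yeqmod N (word_op N V (K (delta a yone)) [::])
    (word_op N V (K (delta [::] (word_op N V (delta a yone) [::]))) [::]) ->
  (forall b, is_composition b -> sumn b < N -> U b <-> ok a b /\ sz a b = n) ->
  (forall b, is_composition b -> sumn b < N ->
     ok [::] b && (sz [::] b == n) = (b == kap)) ->
  fps_mul (qschur kap) (qschur a) m =
  fps_sum [set b | is_composition b /\ U b] qschur m.
Proof.
move=> bm KE eqK UE kapE; set S := word_op N V (delta a yone) [::] in eqK.
set WW := subwords (letters N V).
have small w b : mdvd (content w) m -> grows w [::] = Some b ->
    is_composition b /\ sumn b < N.
  move=> /(bounded_dvd bm)[+ _] gw; rewrite (sumn_grows gw) mdeg_content.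
  by split=> //; apply: grows_composition gw _.
transitivity (word_op N V (K (delta [::] S)) [::] n m).
  pose Wk := [seq content w | w <- WW & grows w [::] == Some kap].
  rewrite (@fps_mul_list _ _ _ Wk) => [|d dm]; last first.
    rewrite (qschurE kap (bounded_dvd bm dm)) /Wk big_map big_filter
      [RHS]big_mkcond.
    by apply: eq_bigr => w _; case: ifP.
  rewrite /Wk big_map big_filter big_mkcond word_op_sum yser_sum.
  apply: eq_bigr => w _; case gw: (grows w [::]) => [b|] /=;
    last by rewrite mulXs0.
  rewrite mulXsE; case dw: (mdvd (content w) m); last by case: ifP.
  have [cb bN] := small w b dw gw.
  rewrite (_ : (Some b == Some kap) = (b == kap)) // -(kapE b cb bN) KE.
  case: ifP => [/andP[-> /eqP ->]|].
    by rewrite iter_mulY leqnn subnn /S word_op_qschur //;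
      apply: bounded_div bm dw.
  (* A strip of another size contributes nothing to y^n, since [S] contains no positive power of y
     up to the degree considered. *)
  case: ifP => //= _ ne; rewrite iter_mulY; case: ifP => // le.
  rewrite /S word_op_qschur; last exact: bounded_div bm dw.
  by rewrite subn_eq0 (_ : (n <= _) = false) //; apply/negbTE; move: ne le; lia.
rewrite -eqK; last by case: bm.
pose good w := if grows w [::] is Some b then ok a b &&
  (sz a b == n) else false.
have -> : word_op N V (K (delta a yone)) [::] n m =
    (\sum_(w <- WW) (good w && (content w == m))%:R)%R.
  rewrite word_op_sum yser_sum; apply: eq_bigr => w _; rewrite /good.
  case gw: (grows w [::]) => [b|] /=; last by rewrite mulXs0.
  rewrite KE; case: ifP => [_|_]; last by rewrite mulXs0.
  rewrite mulXsE iter_mulY -[content w == m]/(true && (content w == m)).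
  have := mulXs_one w 0 m; rewrite mulXsE /yone /= => e1.
  have [->|ne] := eqVneq (sz a b) n; first by rewrite leqnn subnn /= e1.
  case: ifP => // _; case: ifP => // le.
  by rewrite (_ : (n - sz a b == 0) = false) //; apply/negbTE; move: ne le; lia.
rewrite /fps_sum.
(* The compositions reached by some word of content [m] and carrying a strip of size [n]; they
   support the sum at [m]. *)
pose Bs := undup (pmap (fun w =>
  grows w [::]) [seq w <- WW | good w && (content w == m)]).
rewrite (@fsum_list _ _ _ Bs) ?undup_uniq //; last first.
- move=> b [cb Ub]; rewrite (qschurE b bm) => ne; apply/negPn/negP => bB.
  apply: ne; rewrite big_seq big1 // => w wW;
    case: andP => // -[/eqP gw /eqP cw].
  move: bB; rewrite mem_undup mem_pmap => /negP[].
  rewrite -gw; apply: map_f; rewrite mem_filter wW cw eqxx /good gw !andbT.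
  have [_ bN] : is_composition b /\ sumn b < N by apply: small gw;
    rewrite cw mdvd_refl.
  by have [-> ->] := (UE b cb bN).1 Ub; rewrite eqxx.
- move=> b; rewrite mem_undup mem_pmap => /mapP[w].
  rewrite mem_filter => /andP[/andP[gd /eqP cw] _] /esym gw.
  have [cb bN] : is_composition b /\ sumn b < N by apply: small gw;
    rewrite cw mdvd_refl.
  split=> //; apply/(UE b cb bN); move: gd; rewrite /good gw.
  by move=> /andP[-> /eqP].
under [RHS]eq_bigr do rewrite (qschurE _ bm).
rewrite exchange_big; apply: eq_big_seq => w wW.
have [cw|_] := eqVneq (content w) m; last first.
  by rewrite andbF big1 // => b _; rewrite andbF.
rewrite andbT; case gw: (grows w [::]) => [b|]; last first.
  by rewrite /good gw big1.
rewrite (eq_bigr (fun c => ((b == c)%:R * 1)%R)); last first.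
  by move=> c _; rewrite andbT mulr1.
rewrite (big_eq_uniq b (fun=> 1%R)) ?undup_uniq //.
rewrite mem_undup mem_pmap; case: ifP => [/mapP[w']|bB].
  rewrite mem_filter => /andP[/andP[gd _] _] gw'; move: gd.
  by rewrite /good gw -gw' => ->.
case gd: (good w) => //; move/negP: bB; case; rewrite -gw; apply: map_f.
by rewrite mem_filter gd cw eqxx.
Qed.

Lemma exists_bounded (m : {cmonom nat}) : exists N V, bounded N V m.
Proof.
exists (mdeg m).+1, (\max_(v <- finsupp m) v).+1; split=> // v mv.
rewrite ltnS (big_rem v) /= ?leq_maxl //.
by rewrite -cmE_neq0 -lt0n.
Qed.

Lemma parts_bounded (N : nat) b : sumn b < N -> {in b, forall p, p <= N}.
Proof. by move=> bN p /mem_leq_sumn pb; apply: ltnW (leq_ltn_trans pb bN). Qed.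

Lemma height0_composition b : is_composition b -> col_height 0 b = size b.
Proof. by rewrite /is_composition all_count => /eqP. Qed.

Lemma composition_height0 b : is_composition b -> col_height 0 b = 0 ->
  b = [::].
Proof. by move=> /height0_composition -> /size0nil. Qed.

(** The removals empty column 0, and a nonempty composition has a cell there. *)
Lemma shrinks_all L b c : uniq L -> 0 \in L -> is_composition b ->
  shrinks (col_diff L [::] b) b = Some c -> c = [::].
Proof.
move=> uL L0 cb sh; apply: composition_height0 (shrinks_composition sh cb) _.
have := shrinks_height 0 sh; rewrite count_col_diff // L0 subn0; lia.
Qed.

Lemma hstrip_nil N n b : 0 < n -> is_composition b -> sumn b < N ->
  (all (fun k => col_height k b <= (col_height k [::]).+1) (rev (iota 0 N)) &&
   (shrinks (col_diff (rev (iota 0 N)) [::] b) b == Some [::])) &&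
  (size (col_diff (rev (iota 0 N)) [::] b) == n) = (b == [:: n]).
Proof.
move=> n0 cb bN; have N0 : 0 \in rev (iota 0 N) by rewrite mem_rev mem_iota;
  lia.
apply/andP/eqP => [[/andP[/allP al /eqP sh] /eqP sn]|bn].
  have := sumn_shrinks sh; rewrite sn /= add0n.
  (* The bound for column 0 leaves at most one part. *)
  have := al 0 N0; rewrite height0_composition //.
  case: b cb {bN al sh sn} => [|p [|q b]] //= _ _; rewrite ?addn0 => e.
    by rewrite -e in n0.
  by rewrite e.
have le1 k : col_height k b <= 1 by rewrite bn /col_height /=; case: (k < n).
have [|c sh] := @hstrip_shrinks [::] b N (parts_bounded bN);
  first by move=> k; apply: le1.
have c0 : c = [::] by apply: shrinks_all sh => //; rewrite rev_uniq iota_uniq.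
rewrite c0 in sh; rewrite sh eqxx andbT; split; first by apply/allP => k _;
  apply: le1.
by have := sumn_shrinks sh; rewrite {1}bn /= addn0 => ->.
Qed.

Lemma vstrip_nil N n b : 0 < n -> is_composition b -> sumn b < N ->
  (shrinks (col_diff (iota 0 N) [::] b) b == Some [::]) &&
  (size (col_diff (iota 0 N) [::] b) == n) = (b == nseq n 1).
Proof.
move=> n0 cb bN; have N0 : 0 \in iota 0 N by rewrite mem_iota; lia.
apply/andP/eqP => [[/eqP sh /eqP sn]|bn].
  have := sumn_shrinks sh; rewrite sn /= add0n => sb.
  (* Column 1 of [b] has to be empty, so all parts are 1. *)
  have h1 := shrinks_vertical (sorted_col_diff _ _ _ _) sh 0.
  have b1 : all (pred1 1) b.
    apply/allP => p pb; have p0 := allP cb p pb; rewrite /= eqn_leq p0 andbT.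
    rewrite leqNgt; apply/negP => p1; move: h1; rewrite leqn0 => /eqP.
    by apply/eqP; rewrite -lt0n -has_count; apply/hasP; exists p.
  have := all_pred1P _ _ b1 => e; rewrite e sumn_nseq mul1n in sb.
  by rewrite e sb.
have h0 k : col_height k.+1 b = 0.
  by rewrite bn /col_height count_nseq.
have [||c sh] := @vstrip_shrinks [::] b N; [by [] | by move=> k; rewrite h0 |].
have c0 : c = [::] by apply: shrinks_all sh => //; rewrite iota_uniq.
rewrite c0 in sh; rewrite sh eqxx; split=> //.
by have := sumn_shrinks sh; rewrite {1}bn /= sumn_nseq mul1n add0n => ->.
Qed.

Theorem theorem6p7 (alpha : seq nat) (n : nat)
    (alpha_comp : is_composition alpha) (n_gt0 : 0 < n) :
  fps_mul (qschur [:: n]) (qschur alpha) =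
    fps_sum
      [set beta | is_composition beta /\
        included (sort_partition alpha) (sort_partition beta) /\
        let delta := skew (sort_partition beta) (sort_partition alpha) in
        horizontal_strip delta /\ size delta = n /\
        row_op (strip_colset delta) beta = alpha]
      qschur
  /\
  fps_mul (qschur (nseq n 1)) (qschur alpha) =
    fps_sum
      [set beta | is_composition beta /\
        included (sort_partition alpha) (sort_partition beta) /\
        let epsilon := skew (sort_partition beta) (sort_partition alpha) in
        vertical_strip epsilon /\ size epsilon = n /\
        col_op (strip_colmset epsilon) beta = alpha]
      qschur.
Proof.
split; apply/funext => m; have [N [V bm]] := exists_bounded m.
- pose L := rev (iota 0 N).
  apply: (@pieri_of_operator (shrink_strip mulY N)
    (fun a b => all (fun k => col_height k b <= (col_height k a).+1) L &&
       (shrinks (col_diff L a b) b == Some a))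
    (fun a b => size (col_diff L a b)) [:: n] alpha n N V m _ bm) => //.
  + by move=> a u b; rewrite shrink_stripE hstrip_delta // rev_uniq iota_uniq.
  (* After multiplication by the product of the 1 - x_i y, both sides become the series of [alpha],
     as R(y) fixes the empty composition. *)
  + apply: (@qprod_inj _ V) => k d dN.
    have nilE g : yeqmod N (qprod mulY V (word_op N V (shrink_strip mulY N g)
      [::]))
        (word_op N V g [::]).
      by move=> k' d' dN'; rewrite (@word_op_hstrip N V g [::]) //
        shrink_strip_nil.
    by rewrite !nilE // word_op_delta_nil.
  + move=> b cb bN; rewrite (hstrip_iff n alpha cb (parts_bounded bN)).
    split=> [[h1 h2 h3]|[/andP[h1 /eqP h2] h3]]; last by split.
    by rewrite h1 h2 eqxx.
  + by move=> b cb bN; apply: hstrip_nil.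
- apply: (@pieri_of_operator (shrink_vstrip mulY N)
    (fun a b => shrinks (col_diff (iota 0 N) a b) b == Some a)
    (fun a b => size (col_diff (iota 0 N) a b)) (nseq n 1) alpha n N V m _ bm)
      => //.
  + by move=> a u b; rewrite shrink_vstripE vstrip_delta // iota_uniq.
  (* Both sides are the product of the 1 + x_i y times the series of [alpha]. *)
  + move=> k d dN.
    by rewrite !(@word_op_vstrip N V _ [::]) // !shrink_vstrip_nil
      word_op_delta_nil.
  + move=> b cb bN; rewrite (vstrip_iff n alpha cb (parts_bounded bN)).
    by split=> [[-> ->]|[/eqP -> ->]].
  + by move=> b cb bN; apply: vstrip_nil.
Qed.
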